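(* Let $n\ge1$ and $m\ge 1$ be integers. Let $L\subset\mathbb{C}$ be a compact set containing at least $n+1$ points, let $w_L:L\to[0,\infty)$ be a bounded upper semi-continuous weight on $L$ that is nonzero on at least $n+1$ points of $L$, and let $p(z)=a_m z^m+\dots+a_0$ be a polynomial with complex coefficients of degree $m$ (so $a_m\ne0$). Define $K=p^{-1}(L)$ and $w_K(z)=w_L(p(z))$ for $z\in K$. Then $$T_{nm,w_K}^{(K)}(z)=\frac{T_{n,w_L}^{(L)}(p(z))}{a_m^n},\qquad t_{nm}(K,w_K)=\frac{t_n(L,w_L)}{|a_m^n|},$$ and if, in addition, $\operatorname{cap}(L)>0$, then $$\mathcal{W}_{nm}(K,w_K)=\mathcal{W}_n(L,w_L).$$
   Context: For a compact set $E\subset\mathbb{C}$ and a bounded weight $w:E\to[0,\infty)$ nonzero on at least $k+1$ points of $E$, let $\|P\|_{E,w}=\sup_{z\in E}w(z)|P(z)|$. The weighted Chebyshev polynomial $T_{k,w}^{(E)}$ is the (unique) monic polynomial of degree $k$ minimizing $\|\cdot\|_{E,w}$ among all monic polynomials of degree $k$ with complex coefficients, and $t_k(E,w)=\|T_{k,w}^{(E)}\|_{E,w}$. $\operatorname{cap}(E)$ denotes the logarithmic capacity of $E$, and when $\operatorname{cap}(E)>0$ the Widom factor is $\mathcal{W}_k(E,w)=t_k(E,w)/\operatorname{cap}(E)^k$. A weight $w:E\to[0,\infty)$ is upper semi-continuous if $w(z)\ge\limsup_{E\ni\zeta\to z}w(\zeta)$ for each accumulation point $z$ of $E$. *)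

(* Defs.v *)
From HB Require Import structures.
From mathcomp Require Export all_boot all_order all_algebra.
From mathcomp Require Export all_classical all_reals all_analysis.
From mathcomp Require Export complex.
Export Order.TTheory GRing.Theory Num.Theory numFieldNormedType.Exports.

#[export] Set Implicit Arguments.
#[export] Unset Strict Implicit.
#[export] Unset Printing Implicit Defensive.

Local Open Scope classical_set_scope.
Local Open Scope ring_scope.

(* [R[i]] packaged as a [numClosedFieldType], so that it inherits the metric
   topology that MathComp-Analysis attaches to such fields. *)
Definition cplx (R : realType) : numClosedFieldType := R[i].

(* The real-valued modulus; the norm [`|z|] takes its values in [cplx R]. *)
Definition cmod (R : realType) (z : cplx R) : R := Normc.normc z.

(* A weight on [E] is a function on the whole plane, of which only the values
   on [E] are ever used. *)

(* [limf_esup] is taken along the deleted neighbourhoods of [z] in [E].  An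
   accumulation point of a closed [E] belongs to [E]. *)
Definition usc_weight (R : realType) (E : set (cplx R)) (w : cplx R -> R) :=
  forall z, limit_point E z ->
    (limf_esup (EFin \o w) (within E z^') <= (w z)%:E)%E.

Definition wnorm (R : realType) (E : set (cplx R)) (w : cplx R -> R)
    (P : {poly cplx R}) : R :=
  sup [set w z * cmod P.[z] | z in E].

Definition is_chebyshev (R : realType) (E : set (cplx R)) (w : cplx R -> R)
    (k : nat) (P : {poly cplx R}) : Prop :=
  [/\ P \is monic, size P = k.+1 &
      forall Q : {poly cplx R}, Q \is monic -> size Q = k.+1 ->
        wnorm E w P <= wnorm E w Q].

(* For [E] compact and [w] bounded, nonnegative and nonzero on at least [k + 1]
   points of [E], exactly one polynomial satisfies [is_chebyshev E w k], so the
   default value [0] is never selected. *)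
Definition chebyshev (R : realType) (E : set (cplx R)) (w : cplx R -> R)
    (k : nat) : {poly cplx R} :=
  xget 0 (is_chebyshev E w k).

Definition cheb_norm (R : realType) (E : set (cplx R)) (w : cplx R -> R)
    (k : nat) : R :=
  wnorm E w (chebyshev E w k).

(* The complex plane with its Borel sigma-algebra. *)
Definition borel_cplx (R : realType) := g_sigma_algebraType (@open (cplx R)).

(* [log (1 / |z - u|)], equal to [+oo] on the diagonal since [lne 0 = -oo]. *)
Definition log_kernel (R : realType) (z u : cplx R) : \bar R :=
  (- lne (cmod (z - u))%:E)%E.

Definition log_energy (R : realType) (mu : probability (borel_cplx R) R) :
    \bar R :=
  (\int[mu]_z \int[mu]_u log_kernel z u)%E.

(* The Robin constant: the infimum of the energies of the Borel probability
   measures carried by [E]; it is [+oo] when there is none of finite energy. *)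
Definition robin (R : realType) (E : set (cplx R)) : \bar R :=
  ereal_inf [set log_energy mu | mu in
    [set mu : probability (borel_cplx R) R | mu E = 1%E]].

(* The logarithmic capacity of a compact [E]: the Robin constant is then not
   [-oo], and [expeR (-oo) = 0], so that polar sets have capacity [0]. *)
Definition cap (R : realType) (E : set (cplx R)) : R :=
  fine (expeR (- robin E)%E).

Definition widom (R : realType) (E : set (cplx R)) (w : cplx R -> R)
    (k : nat) : R :=
  cheb_norm E w k / cap E ^+ k.

(* Main.v *)
Require Import Defs.
From mathcomp Require Import measurable_realfun ring lra zify.

Local Open Scope classical_set_scope.
Local Open Scope card_scope.
Local Open Scope ring_scope.

(** Chebyshev polynomials. Averaging a monic polynomial Q of degree nm over the
    fibres of p gives a polynomial in the value of p, because the sum of z^i over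
    the roots z of p - w does not depend on w for i < m. Up to the factor a_m^n
    this average is monic of degree n, and it is pointwise dominated by Q on the
    fibre, so T_n(p) / a_m^n is minimal; uniqueness of minimal polynomials does
    the rest.

    Capacity. For a probability tau on L let nu be the average of its images
    under m Borel branches of p^-1. As log |p(z) - w| is log |a_m| plus the sum
    of log |z - r| over the fibre of w, the energies of nu and tau are related by
    m I(nu) = I(tau) + log |a_m|, which bounds the Robin constant of K from
    above. For the lower bound, start from mu on K, let tau be its image under p
    and nu as above. Then I(mu, nu) = I(nu), and positive definiteness,
    2 I(mu, nu) <= I(mu) + I(nu), gives I(nu) <= I(mu) as soon as I(nu) is
    finite. Finiteness is obtained by first restricting mu to a set where its
    potential is bounded. Hence cap(K)^m = cap(L) / |a_m|. *)

(** The obstacle is infinite energy: if I(nu) is infinite then so is I(mu, nu), and positive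
    definiteness compares infinities. A bound for the potential of mu on all of K would exclude
    this, but restricting mu to a set S bounds the potential on S only, while the fibres of p leave
    S. Hence a maximum principle; its additive loss is harmless because it only serves finiteness.
    The restriction itself costs a factor (1 - J / N)^-2, which tends to 1.

    The kernel -log |z - u| is positive definite only up to functions of one variable. On the
    Riemann sphere, 1 minus the scalar product of two points is |z - u|^2 up to factors in z and in
    u, and -log (1 - x) = sum x^j / j has nonnegative coefficients, so it is a limit of positive
    definite kernels of finite rank. The one-variable terms contribute equally to both sides of the
    inequality, since mu and nu have the same mass. Shifting the kernel by a constant makes it
    nonnegative on the sets at hand, so that Tonelli and monotone convergence apply to infinite
    energies too. *)

Arguments cmod : simpl never.

(** * The complex modulus and bounded sets *)

Section Modulus.
Variable R : realType.
Implicit Types (z u : cplx R) (p q : {poly cplx R}).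

Lemma cmod_norm z : `|z| = ((cmod z)%:C)%C.
Proof. by case: z. Qed.

Lemma cmod_sqr z : cmod z ^+ 2 = complex.Re z ^+ 2 + complex.Im z ^+ 2.
Proof. by case: z => x y; rewrite sqr_sqrtr// addr_ge0// sqr_ge0. Qed.

Lemma cmod_ge0 z : 0 <= cmod z.
Proof. by case: z => x y; exact: sqrtr_ge0. Qed.

Lemma cmod0 : cmod (0 : cplx R) = 0.
Proof. exact: Normc.normc0. Qed.

Lemma cmod1 : cmod (1 : cplx R) = 1.
Proof. exact: Normc.normc1. Qed.

Lemma cmod_eq0 z : (cmod z == 0) = (z == 0).
Proof.
by apply/eqP/eqP => [/Normc.eq0_normc//|->]; exact: cmod0.
Qed.

Lemma cmod_gt0 z : (0 < cmod z) = (z != 0).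
Proof. by rewrite lt_def cmod_ge0 andbT cmod_eq0. Qed.

Lemma cmodM z u : cmod (z * u) = cmod z * cmod u.
Proof. exact: Normc.normcM. Qed.

Lemma cmodV z : cmod z^-1 = (cmod z)^-1.
Proof. exact: Normc.normcV. Qed.

Lemma cmodD z u : cmod (z + u) <= cmod z + cmod u.
Proof. exact: le_normcD. Qed.

Lemma cmodN z : cmod (- z) = cmod z.
Proof. exact: normcN. Qed.

Lemma cmodBC z u : cmod (z - u) = cmod (u - z).
Proof. by rewrite -cmodN opprB. Qed.

Lemma cmodB z u : cmod (z - u) <= cmod z + cmod u.
Proof. by rewrite -(cmodN u) cmodD. Qed.

Lemma cmodX z k : cmod (z ^+ k) = cmod z ^+ k.
Proof. by elim: k => [|k IH]; rewrite ?cmod1// !exprS cmodM IH. Qed.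

Lemma cmod_real (x : R) : cmod ((x%:C)%C : cplx R) = `|x|.
Proof. by rewrite /cmod /= expr0n /= addr0 sqrtr_sqr. Qed.

Lemma cmod_nat k : cmod (k%:R : cplx R) = k%:R.
Proof. by rewrite -(rmorph_nat (real_complex R)) cmod_real ger0_norm. Qed.

Lemma cmod_sum (I : Type) (r : seq I) (P : pred I) (F : I -> cplx R) :
  cmod (\sum_(i <- r | P i) F i) <= \sum_(i <- r | P i) cmod (F i).
Proof.
elim/big_rec2: _ => [|i y x _ IH]; first by rewrite cmod0.
by rewrite (le_trans (cmodD _ _))// lerD2l.
Qed.

Lemma cmod_prod (I : Type) (r : seq I) (P : pred I) (F : I -> cplx R) :
  cmod (\prod_(i <- r | P i) F i) = \prod_(i <- r | P i) cmod (F i).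
Proof. by apply: big_morph; [exact: cmodM|exact: cmod1]. Qed.

Lemma Re_le_cmod z : `|complex.Re z| <= cmod z.
Proof.
by rewrite -(ler_pXn2r (n := 2)) ?nnegrE ?cmod_ge0// cmod_sqr real_normK ?num_real// lerDl sqr_ge0.
Qed.

Lemma Im_le_cmod z : `|complex.Im z| <= cmod z.
Proof.
by rewrite -(ler_pXn2r (n := 2)) ?nnegrE ?cmod_ge0// cmod_sqr real_normK ?num_real// lerDr sqr_ge0.
Qed.

Lemma cmod_le_ReIm z : cmod z <= `|complex.Re z| + `|complex.Im z|.
Proof.
case: z => a b; rewrite -(ler_pXn2r (n := 2)) ?nnegrE ?addr_ge0 ?cmod_ge0//.
rewrite cmod_sqr /= sqrrD !real_normK ?num_real// lerD2r lerDl.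
by rewrite mulrn_wge0// mulr_ge0.
Qed.

Definition cbounded (E : set (cplx R)) :=
  exists2 B : R, 0 <= B & forall z, E z -> cmod z <= B.

Lemma compact_cbounded (E : set (cplx R)) : compact E -> cbounded E.
Proof.
move=> Eco.
have covE : E `<=` \bigcup_(n in [set: nat]) (ball (0 : cplx R) (n.+1%:R)).
  move=> z _; exists (Num.truncn (cmod z)) => //=.
  rewrite -ball_normE /= sub0r normrN cmod_norm -(rmorph_nat (real_complex R)) ltcR.
  exact: truncnS_gt.
move: Eco; rewrite compact_cover => /(_ _ _ _ _ covE)[|D _ ED].
  move=> n _; exact: ball_open.
(* The sum of the radii of the finite subcover stands in for their maximum. *)
exists (\sum_(i <- finmap.enum_fset D) i.+1%:R); first by rewrite sumr_ge0.
move=> z /ED[i /= iD].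
rewrite -ball_normE /= sub0r normrN cmod_norm -(rmorph_nat (real_complex R)) ltcR.
move=> /ltW/le_trans; apply.
by rewrite (big_rem i)//= lerDl sumr_ge0.
Qed.

Lemma horner_cbounded E p : cbounded E ->
  exists2 B : R, 0 <= B & forall z, E z -> cmod p.[z] <= B.
Proof.
move=> [B B0 EB].
exists (\sum_(i < size p) cmod p`_i * B ^+ i).
  by rewrite sumr_ge0// => i _; rewrite mulr_ge0 ?cmod_ge0 ?exprn_ge0.
move=> z Ez; rewrite horner_coef (le_trans (cmod_sum _ _ _))//.
apply: ler_sum => i _; rewrite cmodM cmodX ler_wpM2l ?cmod_ge0//.
by rewrite lerXn2r ?nnegrE ?cmod_ge0// EB.
Qed.

Lemma poly_roots p : {rs : seq (cplx R) | p = lead_coef p *: \prod_(z <- rs) ('X - z%:P)}.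
Proof. exact: closed_field_poly_normal. Qed.

(** When |z| exceeds the bound [M] below, every root r has |z - r| >= 1 + B / |a|. One such factor
    already makes |a| |z - r| > B, and the others are at least 1. *)
Lemma preimage_cbounded (L : set (cplx R)) p : (1 < size p)%N ->
  cbounded L -> cbounded [set z | L p.[z]].
Proof.
move=> sp [B B0 LB]; have [rs prs] := poly_roots p.
have p0 : lead_coef p != 0.
  by rewrite lead_coef_eq0; apply: contraTneq sp => ->; rewrite size_poly0.
have rs1 : (0 < size rs)%N.
  move: sp; rewrite prs size_scale//.
  by rewrite -(big_map id xpredT (fun z => 'X - z%:P)) size_prod_XsubC map_id.
pose M := \sum_(z <- rs) cmod z + 1 + B / cmod (lead_coef p).
have S0 : 0 <= \sum_(z <- rs) cmod z by rewrite sumr_ge0// => *; rewrite cmod_ge0.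
have D0 : 0 <= B / cmod (lead_coef p) by rewrite divr_ge0// cmod_ge0.
have M0 : 0 <= M by rewrite /M !addr_ge0.
exists M => // z /= /LB; rewrite leNgt; apply: contraTT; rewrite -ltNge => zM.
have H r : r \in rs -> 1 + B / cmod (lead_coef p) <= cmod (z - r).
  move=> rrs; have : cmod z <= cmod (z - r) + cmod r.
    by rewrite (le_trans _ (cmodD _ _))// subrK.
  have : cmod r <= \sum_(z <- rs) cmod z.
    by rewrite (big_rem r)//= lerDl sumr_ge0// => *; rewrite cmod_ge0.
  move: zM; rewrite /M; lra.
rewrite negbK prs hornerZ horner_prod cmodM cmod_prod.
rewrite (eq_big_seq (fun r => cmod (z - r))); last first.
  by move=> r _; rewrite hornerXsubC.
move: H rs1 {prs M S0 M0 zM}; case: rs => // r rs H _.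
rewrite big_cons.
suff H1 : 1 <= \prod_(j <- rs) cmod (z - j).
  have := H r (mem_head _ _) => Hr.
  rewrite mulrA; apply: (@lt_le_trans _ _ (cmod (lead_coef p) * cmod (z - r))).
    rewrite (lt_le_trans _ (ler_wpM2l (cmod_ge0 _) Hr))// mulrDr mulrCA divff ?cmod_eq0//.
    by rewrite !mulr1 ltrDr cmod_gt0.
  by rewrite ler_peMr// mulr_ge0 ?cmod_ge0.
have : forall j, j \in rs -> 1 <= cmod (z - j).
  move=> j jrs; rewrite (le_trans _ (H j _)) ?lerDl// inE jrs orbT //.
elim: rs {H} => [|j rs IH] H; first by rewrite big_nil.
rewrite big_cons mulr_ege1// ?H ?mem_head// IH// => k krs.
by rewrite H// inE krs orbT.
Qed.

End Modulus.

(** * Weighted Chebyshev polynomials *)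

Section WeightedNorm.
Variables (R : realType) (E : set (cplx R)) (w : cplx R -> R) (M : R).
Hypotheses (Eb : cbounded E) (w_ge0 : forall z, E z -> 0 <= w z)
  (w_le : forall z, E z -> w z <= M).
Implicit Types P Q : {poly cplx R}.

Lemma wnorm_ub P z : E z -> w z * cmod P.[z] <= wnorm E w P.
Proof.
move=> Ez; apply: ub_le_sup; last by exists z.
have [B B0 EB] := horner_cbounded P Eb.
exists (M * B) => _ [u Eu <-].
by rewrite ler_pM ?cmod_ge0 ?w_ge0 ?w_le ?EB.
Qed.

(** The hypothesis [0 <= b] covers an empty [E], where [sup] takes the value 0. *)
Lemma wnorm_le P b : 0 <= b -> (forall z, E z -> w z * cmod P.[z] <= b) ->
  wnorm E w P <= b.
Proof.
move=> b0 Hb; have [[z Ez]|E0] := pselect (E !=set0).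
  by apply: ge_sup; [exists (w z * cmod P.[z]); exists z|move=> _ [u Eu <-]; exact: Hb].
rewrite /wnorm (_ : E = set0) ?image_set0 ?sup0//.
by apply: contrapT => /eqP/set0P.
Qed.

Lemma wnorm_ge0 P : 0 <= wnorm E w P.
Proof.
have [[z Ez]|E0] := pselect (E !=set0).
  by rewrite (le_trans _ (wnorm_ub P Ez))// mulr_ge0 ?cmod_ge0 ?w_ge0.
rewrite /wnorm (_ : E = set0) ?image_set0 ?sup0//.
by apply: contrapT => /eqP/set0P.
Qed.

Lemma wnormD P Q : wnorm E w (P + Q) <= wnorm E w P + wnorm E w Q.
Proof.
apply: wnorm_le => [|z Ez]; first by rewrite addr_ge0 ?wnorm_ge0.
rewrite hornerD (le_trans (ler_wpM2l (w_ge0 Ez) (cmodD _ _)))//.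
by rewrite mulrDr lerD ?wnorm_ub.
Qed.

Lemma wnormZ (c : cplx R) P : wnorm E w (c *: P) <= cmod c * wnorm E w P.
Proof.
apply: wnorm_le => [|z Ez]; first by rewrite mulr_ge0 ?wnorm_ge0 ?cmod_ge0.
by rewrite hornerZ cmodM mulrCA ler_wpM2l ?cmod_ge0 ?wnorm_ub.
Qed.

Lemma wnorm_sum n (F : 'I_n -> {poly cplx R}) :
  wnorm E w (\sum_(i < n) F i) <= \sum_(i < n) wnorm E w (F i).
Proof.
elim/big_rec2: _ => [|i y x _ IH].
  by apply: wnorm_le => // z _; rewrite horner0 cmod0 mulr0.
by rewrite (le_trans (wnormD _ _))// lerD2l.
Qed.

(** Here x and y are the weighted values of R and D, and s bounds R div D. The hypothesis yields x
    <= t - y^2 / (8 t). Half of that loss survives the factor 1 - e and absorbs e s y up to 4 t e^2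
    s^2; the choice of e makes this remainder at most t e / 2, half of the gain t e. *)
Lemma convex_gain (t s x y : R) : 0 < t -> 0 <= s -> 0 <= x -> 0 <= y ->
  x ^+ 2 + y ^+ 2 / 4 <= t ^+ 2 ->
  let e := (8 * s ^+ 2 + 2)^-1 in (1 - e) * x + e * s * y <= t * (1 - e / 2).
Proof.
move=> t0 s0 x0 y0 xyt; set e := (_)^-1; rewrite /=.
have d0 : 0 < 8 * s ^+ 2 + 2 by rewrite ltr_wpDl// mulr_ge0// sqr_ge0.
have e0 : 0 < e by rewrite invr_gt0.
have ed : e * (8 * s ^+ 2 + 2) = 1 by rewrite mulVf// gt_eqF.
have es : 0 <= s ^+ 2 by exact: sqr_ge0.
have e12 : e <= 1/2 by nra.
have xt : x <= t - y ^+ 2 / (8 * t).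
  have yt : y ^+ 2 <= 4 * t ^+ 2 by nra.
  have q : y ^+ 2 / (8 * t) * (8 * t) = y ^+ 2 by rewrite divfK// gt_eqF// mulr_gt0.
  set q' := y ^+ 2 / (8 * t) in q *.
  have q0 : 0 <= q' by rewrite divr_ge0 ?sqr_ge0// mulr_ge0// ltW.
  have tq : 0 <= t - q' by nra.
  rewrite -(ler_pXn2r (n := 2))// ?nnegrE//.
  nra.
apply: (@le_trans _ _ ((1 - e) * (t - y ^+ 2 / (8 * t)) + e * s * y)).
  rewrite lerD2r ler_wpM2l//; lra.
have q : y ^+ 2 / (8 * t) * (8 * t) = y ^+ 2 by rewrite divfK// gt_eqF// mulr_gt0.
set q' := y ^+ 2 / (8 * t) in q *.
have q0 : 0 <= q' by rewrite divr_ge0 ?sqr_ge0// mulr_ge0// ltW.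
have H1 : (1 - e) * q' >= q' / 2 by nra.
have H2 : e * s * y <= q' / 2 + 4 * t * e ^+ 2 * s ^+ 2.
  rewrite -(ler_pM2r (_ : 0 < 16 * t)) ?mulr_gt0//.
  rewrite (_ : (q' / 2 + _) * (16 * t) = y ^+ 2 + 64 * t ^+ 2 * e ^+ 2 * s ^+ 2); last first.
    by rewrite -q; field.
  have := sqr_ge0 (y - 8 * t * e * s); nra.
have H3 : 4 * e * s ^+ 2 <= 1/2 by lra.
have H4 : 4 * t * e ^+ 2 * s ^+ 2 <= t * e / 2.
  have := ler_wpM2l (ltW (mulr_gt0 t0 e0)) H3; lra.
lra.
Qed.

(* With R = (P + Q) / 2, D = P - Q and B = R mod D, the parallelogram law gives
   w |R| <= t - (w |D|)^2 / (8 t), so that R - e B = (1 - e) R + e D (R div D)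
   has norm less than t for small e. *)
Lemma is_chebyshev_unique k P Q : 0 < wnorm E w P ->
  is_chebyshev E w k P -> is_chebyshev E w k Q -> P = Q.
Proof.
move=> t0 [Pm Ps Pmin] [Qm Qs Qmin]; apply/eqP; apply: contraT => PQ.
set t := wnorm E w P in t0.
have tQ : wnorm E w Q = t by apply: le_anti; rewrite Qmin//= Pmin.
pose H : {poly cplx R} := 2^-1 *: (P + Q); pose D := P - Q.
have D0 : D != 0 by rewrite subr_eq0.
have [s s0 Es] := horner_cbounded (H %/ D) Eb.
pose e := (8 * s ^+ 2 + 2)^-1.
pose V := H - (e%:C)%C *: (H %% D).
have hd : H = (H %/ D) * D + H %% D by exact: divp_eq.
have sD : (size D <= k)%N.
  have : (size D <= k.+1)%N.
    by rewrite (leq_trans (size_polyD _ _))// size_polyN Ps Qs maxnn.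
  rewrite leq_eqVlt ltnS => /orP[/eqP sD|//].
  have : lead_coef D != 0 by rewrite lead_coef_eq0.
  rewrite lead_coefE sD /= coefB.
  move: Pm Qm; rewrite !monicE !lead_coefE Ps Qs /= => /eqP-> /eqP->.
  by rewrite subrr eqxx.
have HV : V`_k = 1.
  rewrite coefB [X in _ - X]coefZ (_ : (H %% D)`_k = 0); last first.
    by rewrite nth_default// (leq_trans _ sD)// ltnW// ltn_modp.
  rewrite mulr0 subr0 coefZ coefD.
  move: Pm Qm; rewrite !monicE !lead_coefE Ps Qs /= => /eqP-> /eqP->.
  by rewrite -mulr2n -(mulr_natl 1) mulr1 mulVf// pnatr_eq0.
have Vs : size V = k.+1.
  apply/eqP; rewrite eqn_leq; apply/andP; split; last first.
    rewrite ltnNge; apply/negP => /(nth_default 0); rewrite HV => /eqP.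
    by rewrite oner_eq0.
  rewrite (leq_trans (size_polyD _ _))// geq_max; apply/andP; split.
    rewrite (leq_trans (size_scale_leq _ _))// (leq_trans (size_polyD _ _))//.
    by rewrite Ps Qs maxnn.
  rewrite size_polyN (leq_trans (size_scale_leq _ _))//.
  by rewrite (leq_trans _ (leqW sD))// ltnW// ltn_modp.
have Vm : V \is monic by rewrite monicE lead_coefE Vs HV.
have e0 : 0 < e by rewrite invr_gt0 ltr_wpDl// mulr_ge0// sqr_ge0.
have e1 : e <= 2^-1.
  by rewrite lef_pV2 ?posrE// ?lerDr ?mulr_ge0 ?sqr_ge0// ltr_wpDl// mulr_ge0// sqr_ge0.
have := Pmin _ Vm Vs; rewrite -/t leNgt => /negP; case.
apply: (@le_lt_trans _ _ (t * (1 - e / 2))); last first.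
  by rewrite -[X in _ < X]mulr1 ltr_pM2l// ltrBlDl ltrDr divr_gt0.
apply: wnorm_le => [|z Ez]; first by rewrite mulr_ge0 ?(ltW t0)//; lra.
have wz := w_ge0 Ez.
have VE : V.[z] = (((1 - e)%:C)%C : cplx R) * H.[z] +
     ((e%:C)%C : cplx R) * ((H %/ D).[z] * D.[z]).
  have -> : (H %/ D).[z] * D.[z] = H.[z] - (H %% D).[z].
    by rewrite [X in X.[z] - _]hd [in RHS]hornerD [X in _ = X + _ - _]hornerM addrK.
  rewrite [in LHS]hornerD [in LHS]hornerN [X in _ - X]hornerZ rmorphB rmorph1; ring.
apply: (@le_trans _ _ ((1 - e) * (w z * cmod H.[z]) + e * s * (w z * cmod D.[z]))).
  rewrite VE (le_trans (ler_wpM2l wz (cmodD _ _)))// !cmodM !cmod_real.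
  rewrite (ger0_norm (ltW e0)) ger0_norm; last lra.
  rewrite mulrDr; apply: lerD; first by rewrite mulrCA.
  rewrite [leRHS](_ : _ = w z * (e * (s * cmod D.[z]))); last ring.
  by rewrite ler_wpM2l// ler_wpM2l ?(ltW e0)// ler_wpM2r ?cmod_ge0// Es.
apply: convex_gain => //; rewrite ?mulr_ge0 ?cmod_ge0//.
have := wnorm_ub P Ez; have := wnorm_ub Q Ez; rewrite tQ -/t.
have : 0 <= w z * cmod P.[z] by rewrite mulr_ge0 ?cmod_ge0.
have : 0 <= w z * cmod Q.[z] by rewrite mulr_ge0 ?cmod_ge0.
rewrite !exprMn => a b c d.
have X1 := ler_pM b b d d; have X2 := ler_pM a a c c.
rewrite -!expr2 !exprMn in X1 X2.
have -> : cmod H.[z] ^+ 2 = (2 * cmod P.[z] ^+ 2 + 2 * cmod Q.[z] ^+ 2 - cmod D.[z] ^+ 2) / 4.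
  rewrite /H /D hornerZ cmodM cmodV cmod_nat !hornerD hornerN exprMn.
  rewrite !cmod_sqr; case: (P.[z]) => a' b'; case: (Q.[z]) => c' d' /=; by field.
have F (a1 b1 d1 x1 t1 : R) : x1 * a1 <= t1 -> x1 * b1 <= t1 ->
  x1 * ((2 * a1 + 2 * b1 - d1) / 4) + x1 * d1 / 4 <= t1 by clear; lra.
exact: F.
Qed.

End WeightedNorm.

(** A nonzero polynomial of degree at most n cannot vanish at n + 1 points. Positivity of the
    minimal norm is what the uniqueness argument asks for. *)
Lemma wnorm_gt0 (R : realType) (E : set (cplx R)) (w : cplx R -> R) (M : R) n
    (P : {poly cplx R}) (y : 'I_n.+1 -> cplx R) : cbounded E ->
  (forall z, E z -> 0 <= w z) -> (forall z, E z -> w z <= M) ->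
  injective y -> (forall i, E (y i) /\ w (y i) != 0) -> P != 0 ->
  (size P <= n.+1)%N -> 0 < wnorm E w P.
Proof.
move=> Eb w0 wM yi Ey P0 sP.
have [/forallP Py|/forallPn[i yP]] := boolP [forall i, root P (y i)].
  have := @roots_geq_poly_eq0 _ P (map y (enum 'I_n.+1)).
  rewrite size_map size_enum_ord map_inj_uniq ?enum_uniq// => /(_ _ isT sP) PE.
  by move: P0; rewrite PE ?eqxx//; apply/allP => _ /mapP[i _ ->].
have [Ei wi] := Ey i.
rewrite (lt_le_trans _ (wnorm_ub Eb w0 wM P Ei))//.
by rewrite mulr_gt0 ?cmod_gt0// lt_def wi w0.
Qed.

(** * Existence of minimal polynomials *)

Section Existence.
Variables (R : realType) (E : set (cplx R)) (w : cplx R -> R) (M : R).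
Hypotheses (Eb : cbounded E) (w_ge0 : forall z, E z -> 0 <= w z)
  (w_le : forall z, E z -> w z <= M).
Variables (n : nat) (y : 'I_n -> cplx R).
Hypotheses (y_inj : injective y) (Ey : forall i, E (y i) /\ w (y i) != 0).

(** The Lagrange basis at the nodes [y]. *)
Let ell (i : 'I_n) : {poly cplx R} :=
  (\prod_(j < n | j != i) (y i - y j))^-1 *: \prod_(j < n | j != i) ('X - (y j)%:P).

Let ellE (i j : 'I_n) : (ell i).[y j] = (i == j)%:R.
Proof.
rewrite /ell hornerZ horner_prod; have [<-|ij] := eqVneq i j.
  under eq_bigr do rewrite hornerXsubC.
  rewrite mulVf//; apply/prodf_neq0 => k ki; rewrite subr_eq0.
  by apply: contra_neq ki => /y_inj.
rewrite [X in _ * X](bigD1 j) 1?eq_sym//= hornerXsubC subrr mul0r mulr0.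
by [].
Qed.

Let ell_size i : (size (ell i) <= n)%N.
Proof.
rewrite (leq_trans (size_scale_leq _ _))//.
rewrite -big_filter size_prod_XsubC size_filter.
rewrite -[X in (_ <= X)%N](size_enum_ord n) enumT -(count_predC (pred1 i)).
rewrite -addn1 addnC leq_add// -has_count; apply/hasP; exists i => //=.
by rewrite mem_index_enum.
Qed.

Let node : {poly cplx R} := \prod_(j < n) ('X - (y j)%:P).

Let nodeE j : node.[y j] = 0.
Proof. by rewrite /node horner_prod (bigD1 j)//= hornerXsubC subrr mul0r. Qed.

Let node_monic : node \is monic.
Proof. by rewrite monic_prod// => *; exact: monicXsubC. Qed.

Let node_size : size node = n.+1.
Proof. by rewrite /node size_prod_XsubC [index_enum _]unlock -enumT size_enum_ord. Qed.

(** The n complex nodal values are stored as one real vector, so that the extreme value theorem for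
    real row vectors applies. *)
Let val (v : 'rV[R]_(n + n)) (i : 'I_n) : cplx R :=
  Complex (v ord0 (lshift n i)) (v ord0 (rshift n i)).

(** Adding the nodal polynomial to the Lagrange interpolant parametrises all monic polynomials of
    degree n by their values at the nodes. *)
Let interp (v : 'rV[R]_(n + n)) : {poly cplx R} := node + \sum_(i < n) val v i *: ell i.

Let interp_size v : (size (\sum_(i < n) val v i *: ell i)%R <= n)%N.
Proof.
rewrite (leq_trans (size_sum _ _ _))//; apply/bigmax_leqP => i _.
by rewrite (leq_trans (size_scale_leq _ _))// ell_size.
Qed.

Let sinterp v : size (interp v) = n.+1.
Proof. by rewrite /interp size_polyDl node_size// ltnS interp_size. Qed.

Let minterp v : interp v \is monic.
Proof.
rewrite monicE /interp lead_coefDl ?node_size ?ltnS ?interp_size//.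
Qed.

Let interpE v j : (interp v).[y j] = val v j.
Proof.
rewrite /interp hornerD nodeE add0r horner_sum (bigD1 j)//= hornerZ ellE eqxx.
rewrite mulr1 big1 ?addr0// => i ij; rewrite hornerZ ellE (negbTE ij) mulr0 //.
Qed.

Let interp_surj Q : Q \is monic -> size Q = n.+1 -> exists v, interp v = Q.
Proof.
move=> Qm Qs; pose v : 'rV[R]_(n + n) :=
  row_mx (\row_i complex.Re Q.[y i]) (\row_i complex.Im Q.[y i]).
exists v; apply/eqP; rewrite -subr_eq0; apply/eqP.
apply: (@roots_geq_poly_eq0 _ _ (map y (enum 'I_n))).
- apply/allP => _ /mapP[i _ ->]; rewrite rootE hornerD hornerN interpE /val.
  by rewrite /v row_mxEl row_mxEr !mxE subr_eq0; case: (Q.[_]) => *; apply/eqP.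
- by rewrite map_inj_uniq// enum_uniq.
rewrite size_map size_enum_ord.
have : (size (interp v - Q)%R <= n.+1)%N.
  by rewrite (leq_trans (size_polyD _ _))// size_polyN sinterp Qs maxnn.
rewrite leq_eqVlt ltnS => /orP[/eqP sD|//].
have : lead_coef (interp v - Q) == 0.
  rewrite lead_coefE sD /= coefB; move: (minterp v) Qm.
  by rewrite !monicE !lead_coefE sinterp Qs /= => /eqP-> /eqP->; rewrite subrr.
by rewrite lead_coef_eq0 => /eqP->; rewrite size_poly0.
Qed.

(** The norm is Lipschitz in the nodal values. Since |Q(y i)| is at most the norm of Q divided by
    [w (y i)], every polynomial at least as good as [interp 0] has its nodal values in a fixed box,
    so a minimum over the box is global. *)
Lemma is_chebyshev_exists : exists P, is_chebyshev E w n P.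
Proof.
pose f v := wnorm E w (interp v).
pose La := \sum_(i < n) wnorm E w (ell i).
have La0 : 0 <= La by rewrite sumr_ge0// => i _; exact: (wnorm_ge0 Eb w_ge0 w_le).
have flip (v v' : 'rV[R]_(n + n)) (e : R) : 0 <= e -> (forall j, `|v ord0 j - v' ord0 j| <= e) -> f v - f v' <= 2 * e * La.
  move=> e0 ve; rewrite lerBlDl /f.
  have -> : interp v = interp v' + \sum_(i < n) (val v i - val v' i) *: ell i.
    rewrite /interp -addrA -big_split /=; congr (_ + _); apply: eq_bigr => i _.
    by rewrite -scalerDl addrC subrK.
  rewrite (le_trans (wnormD Eb w_ge0 w_le _ _))// lerD2l.
  rewrite (le_trans (wnorm_sum Eb w_ge0 w_le _))// mulr_sumr ler_sum// => i _.
  rewrite (le_trans (wnormZ Eb w_ge0 w_le _ _))//.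
  rewrite ler_wpM2r ?(wnorm_ge0 Eb w_ge0 w_le)// (le_trans (cmod_le_ReIm _))//=.
  by rewrite mulr_natl mulr2n lerD// ve.
have cf : continuous (f : 'rV[R]_(n + n) -> R).
  move=> v; apply/(@cvgrPdist_lt R R _ (nbhs v) (nbhs_filter v) f) => e e0.
  have d0 : 0 < e / (2 * La + 1) by rewrite divr_gt0// ltr_wpDl// mulr_ge0.
  near=> v'.
  have vv : forall j, `|v ord0 j - v' ord0 j| <= e / (2 * La + 1).
    near: v'; exists (fun i j => ball (v i j) (e / (2 * La + 1))).
      by move=> i j; exact: nbhsx_ballx.
    by move=> v' vv' j; exact/ltW/(vv' ord0 j).
  have vv' : forall j, `|v' ord0 j - v ord0 j| <= e / (2 * La + 1).
    by move=> j; rewrite distrC.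
  have lt1 : 2 * (e / (2 * La + 1)) * La < e.
    have : e / (2 * La + 1) * (2 * La + 1) = e.
      by rewrite divfK// gt_eqF// ltr_wpDl// mulr_ge0.
    have := d0; move: (e / _) => d; move=> *; nra.
  rewrite ltr_norml ltrNl opprB !(le_lt_trans _ lt1)//; apply: flip => //; exact: ltW.
(* A common bound for all nodal values: each is at most its own summand. *)
pose rho := \sum_(i < n) f 0 / w (y i).
have f0 (v : 'rV[R]_(n + n)) : 0 <= f v by exact: (wnorm_ge0 Eb w_ge0 w_le).
have wy i : 0 < w (y i) by have [Ei wi] := Ey i; rewrite lt_def wi w_ge0.
have rho0 : 0 <= rho by rewrite sumr_ge0// => i _; rewrite divr_ge0// ltW.
pose A := [set v : 'rV[R]_(n + n) | forall i, (`[- rho, rho]%classic : set R) (v ord0 i)].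
have cA : compact A.
  by apply: (@rV_compact _ _ (fun=> `[- rho, rho]%classic)) => i; exact: segment_compact.
have fA (v : 'rV[R]_(n + n)) : f v <= f 0 -> A v.
  move=> fv.
  have H i : cmod (val v i) <= rho.
    apply: (@le_trans _ _ (f 0 / w (y i))); last first.
      by rewrite /rho (bigD1 i)//= lerDl sumr_ge0// => j _; rewrite divr_ge0// ltW.
    rewrite ler_pdivlMr// (le_trans _ fv)// mulrC -interpE /f.
    by apply: (wnorm_ub Eb w_ge0 w_le); have [] := Ey i.
  move=> j /=; rewrite in_itv /= -ler_norml.
  case: (split_ordP j) => i ->.
    exact: le_trans (Re_le_cmod (val v i)) (H i).
  exact: le_trans (Im_le_cmod (val v i)) (H i).
have A0 : A !=set0 by exists 0; exact: fA.
have [c _ cmin] := EVT_min_rV A0 cA (continuous_subspaceT cf).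
exists (interp c); split => // Q Qm Qs.
have [v <-] := interp_surj Qm Qs.
have [Av|nAv] := pselect (A v); first by apply: cmin; rewrite inE.
rewrite (le_trans (cmin 0 _)) ?inE//; first exact: fA.
by rewrite leNgt; apply/negP => /ltW/fA.
Unshelve. all: by end_near.
Qed.

End Existence.

(** * Sums over the fibres of a polynomial *)

Section FibreSum.
Variable F : fieldType.
Implicit Types (p q s : {poly F}) (rs : seq F).

(* The residue identity  s P' / P = polynomial + sum_z s(z) / (X - z)  over the
   roots z of P. *)
Lemma residue_sum s rs : let P := \prod_(z <- rs) ('X - z%:P) in
  exists G : {poly F}, [/\ (size G <= size rs)%N,
    ('X * G)`_(size rs) = \sum_(z <- rs) s.[z] & P %| s * P^`() - G].
Proof.
elim: rs => [|z rs [G [sG cG dG]]] /=.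
  by exists 0; rewrite !big_nil size_poly0 mulr0 coef0 dvd1p.
rewrite !big_cons; set P := \prod_(j <- rs) ('X - j%:P) in dG *.
exists (s.[z] *: P + ('X - z%:P) * G); split.
- rewrite (leq_trans (size_polyD _ _))// geq_max; apply/andP; split.
    by rewrite (leq_trans (size_scale_leq _ _))// /P size_prod_XsubC.
  by rewrite (leq_trans (size_polyMleq _ _))// size_XsubC.
- rewrite coefXM /= coefD coefZ.
  have -> : P`_(size rs) = 1.
    have := monic_prod_XsubC rs xpredT id.
    by rewrite monicE lead_coefE size_prod_XsubC /= => /eqP.
  by rewrite mulr1 mulrBl coefB cG coefCM (nth_default _ sG) mulr0 subr0.
have /factor_theorem[q hq] : root (s - (s.[z])%:P) z.
  by rewrite rootE !hornerE subrr.
have -> : s * (('X - z%:P) * P)^`() - (s.[z] *: P + ('X - z%:P) * G) =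
   q * (('X - z%:P) * P) + ('X - z%:P) * (s * P^`() - G).
  rewrite derivM derivB derivX derivC subr0 mul1r mulrA -hq -mul_polyC; ring.
by apply: dvdp_add; [exact: dvdp_mull|exact: dvdp_mul].
Qed.

(** Write s p' = g p + r. Modulo p - w this is r + w g, which by the residue identity equals
    [lead_coef p *: G], and the coefficient of [G] of order m - 1 is the sum. In r + w g that
    coefficient is free of w, because g has size at most m - 1. *)
Lemma fibre_sum_const p s m : size p = m.+1 -> (0 < m)%N -> (size s <= m)%N ->
  exists c, forall w rs, p - w%:P = lead_coef p *: \prod_(z <- rs) ('X - z%:P) ->
    \sum_(z <- rs) s.[z] = c.
Proof.
move=> sp m0 ss; have p0 : p != 0 by rewrite -size_poly_eq0 sp.
have a0 : lead_coef p != 0 by rewrite lead_coef_eq0.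
exists (((s * p^`()) %% p)`_m.-1 / lead_coef p) => w rs prs.
have spw : size (p - w%:P) = m.+1.
  rewrite size_polyDl// size_polyN sp (leq_ltn_trans (size_polyC_leq1 _))//.
have srs : size rs = m.
  by apply/eqP; rewrite -eqSS -spw prs size_scale// size_prod_XsubC.
have [G [sG cG dG]] := residue_sum s rs.
have {}cG : G`_m.-1 = \sum_(z <- rs) s.[z].
  by rewrite -cG coefXM srs; case: (m) m0.
have size_deriv : (size p^`() <= m)%N by rewrite -ltnS -sp lt_size_deriv.
set g := (s * p^`()) %/ p; set r := (s * p^`()) %% p.
have sg : (size g <= m.-1)%N.
  rewrite size_divp// sp /= leq_subLR (leq_trans (size_polyMleq _ _))//.
  by move: m0 ss size_deriv; clear; lia.
have spr : s * p^`() = g * (p - w%:P) + (r + w *: g).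
  by rewrite {1}(divp_eq (s * p^`()) p) -/g -/r -mul_polyC; ring.
have sr : (size r <= m)%N by rewrite -ltnS -sp ltn_modp.
have E : lead_coef p *: G = r + w *: g.
  have dE : p - w%:P %| r + w *: g - lead_coef p *: G.
    have -> : r + w *: g - lead_coef p *: G =
        (s * p^`() - lead_coef p *: G) - g * (p - w%:P) by rewrite spr; ring.
    rewrite dvdp_sub ?dvdp_mull//.
    rewrite (_ : p^`() = (p - w%:P)^`()); last by rewrite derivB derivC subr0.
    by rewrite prs derivZ -scalerAr -scalerBr dvdpZl// dvdpZr.
  apply/esym/eqP; rewrite -subr_eq0; apply: contraT => /dvdp_leq/(_ dE).
  rewrite spw ltnNge (leq_trans (size_polyD _ _))// size_polyN !geq_max.
  rewrite (leq_trans (size_polyD _ _)) ?geq_max ?sr//=.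
    by rewrite (leq_trans (size_scale_leq _ _))// -srs.
  by rewrite (leq_trans (size_scale_leq _ _))// (leq_trans sg)// leq_pred.
rewrite -cG -(mulrK (_ : lead_coef p \is a GRing.unit) G`_m.-1) ?unitfE//.
congr (_ / _); rewrite mulrC -coefZ E coefD coefZ (nth_default _ sg).
by rewrite mulr0 addr0.
Qed.

(** Induction on n through Q = q p + s: on the fibre over w the factor p equals w, and s contributes
    a constant, so Qt = X qt + c. The second conclusion fixes the leading coefficient of Qt without
    a division. *)
Lemma fibre_sum p m n (Q : {poly F}) : size p = m.+1 -> (0 < m)%N -> size Q = (n * m).+1 ->
  exists Qt : {poly F}, [/\ (size Qt <= n.+1)%N,
    Qt`_n * lead_coef p ^+ n = m%:R * lead_coef Q &
    forall w rs, p - w%:P = lead_coef p *: \prod_(z <- rs) ('X - z%:P) ->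
      \sum_(z <- rs) Q.[z] = Qt.[w]].
Proof.
move=> sp m0; have p0 : p != 0 by rewrite -size_poly_eq0 sp.
have a0 : lead_coef p != 0 by rewrite lead_coef_eq0.
elim: n Q => [|n IH] Q sQ.
  have QE : Q = (lead_coef Q)%:P.
    by rewrite lead_coefE sQ /=; apply: size1_polyC; rewrite sQ.
  exists (m%:R * lead_coef Q)%:P; split.
  - by rewrite size_polyC_leq1.
  - by rewrite coefC eqxx mulr1.
  move=> w rs prs; rewrite hornerC QE lead_coefC.
  rewrite (eq_bigr (fun=> lead_coef Q)) => [|z _]; last by rewrite hornerC.
  rewrite big_const_seq count_predT iter_addr_0 mulr_natl; congr (_ *+ _).
  apply/eqP; rewrite -eqSS -sp -(size_prod_XsubC rs id) -(size_scale _ a0) -prs.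
  by rewrite size_polyDl// size_polyN sp (leq_ltn_trans (size_polyC_leq1 _)).
set q := Q %/ p; set s := Q %% p.
have Qq : Q = q * p + s by exact: divp_eq.
have sq : size q = (n * m).+1.
  by rewrite size_divp// sQ sp /= mulSn subSn ?leq_addr// addKn.
have [qt [sqt cqt hqt]] := IH _ sq.
have ss : (size s <= m)%N by rewrite -ltnS -sp ltn_modp.
have [c hc] := fibre_sum_const sp m0 ss.
exists ('X * qt + c%:P); split.
- rewrite (leq_trans (size_polyD _ _))// geq_max.
  rewrite (leq_trans (size_polyC_leq1 _))// andbT.
  by rewrite (leq_trans (size_polyMleq _ _))// size_polyX.
- rewrite coefD coefXM /= coefC /= addr0 exprSr mulrA cqt -mulrA; congr (_ * _).
  rewrite Qq lead_coefDl ?lead_coefM//.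
  rewrite size_mul// -?size_poly_eq0 ?sq// sp (leq_ltn_trans ss)//.
  by rewrite addSn addnS /= ltnS leq_addl.
move=> w rs prs; rewrite !hornerE -(hqt _ _ prs) -(hc _ _ prs).
rewrite mulr_sumr -big_split /=; apply: eq_big_seq => z zrs.
rewrite Qq hornerD hornerM; congr (_ + _); rewrite mulrC; congr (_ * _).
have : (p - w%:P).[z] = 0.
  by rewrite prs hornerZ horner_prod (big_rem z)//= hornerXsubC subrr mul0r mulr0.
by rewrite hornerD hornerN hornerC => /eqP; rewrite subr_eq0 => /eqP.
Qed.

End FibreSum.

(** * Minimal polynomials under composition with [p] *)

Section Composition.
Variables (R : realType) (n m : nat) (L : set (cplx R)) (w : cplx R -> R) (M : R).
Variable p : {poly cplx R}.
Hypotheses (Lb : cbounded L) (w_ge0 : forall z, L z -> 0 <= w z)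
  (w_le : forall z, L z -> w z <= M) (hm : (0 < m)%N) (hp : size p = m.+1).

Let K : set (cplx R) := [set z | L p.[z]].
Let wK z := w p.[z].
Let a := lead_coef p.

Let a0 : a != 0.
Proof. by rewrite lead_coef_eq0 -size_poly_eq0 hp. Qed.

Let Kb : cbounded K.
Proof. by apply: preimage_cbounded => //; rewrite hp. Qed.

Lemma poly_fibre u : {rs | p - u%:P = a *: \prod_(z <- rs) ('X - z%:P) & size rs = m}.
Proof.
have [rs prs] := poly_roots (p - u%:P).
have E : lead_coef (p - u%:P) = a.
  by rewrite lead_coefDl// size_polyN hp (leq_ltn_trans (size_polyC_leq1 _)).
rewrite E in prs; exists rs => //.
apply/eqP; rewrite -eqSS -hp -(size_prod_XsubC rs id) -(size_scale _ a0) -prs.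
by rewrite size_polyDl// size_polyN hp (leq_ltn_trans (size_polyC_leq1 _)).
Qed.

Lemma fibre_root u rs z : p - u%:P = a *: \prod_(z <- rs) ('X - z%:P) ->
  z \in rs -> p.[z] = u.
Proof.
move=> prs zrs; have : (p - u%:P).[z] = 0.
  by rewrite prs hornerZ horner_prod (big_rem z)//= hornerXsubC subrr mul0r mulr0.
by rewrite hornerD hornerN hornerC => /eqP; rewrite subr_eq0 => /eqP.
Qed.

Lemma poly_surj u : exists z, p.[z] = u.
Proof.
have [[|z rs] prs srs] := poly_fibre u; first by move: hm; rewrite -srs.
by exists z; apply: fibre_root prs _; rewrite mem_head.
Qed.

(** Both suprema run over the same set of values, because [p] maps [K] onto [L]. *)
Lemma wnorm_comp P : wnorm K wK (P \Po p) = wnorm L w P.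
Proof.
congr sup; apply/seteqP; split => [_ [z Kz <-]|_ [u Lu <-]].
  by exists p.[z] => //; rewrite horner_comp.
by have [z zu] := poly_surj u; exists z; rewrite /K /wK /= ?horner_comp zu.
Qed.

Lemma wnorm_scale (E : set (cplx R)) (v : cplx R -> R) (c : cplx R) P :
  cbounded E -> (forall z, E z -> 0 <= v z) -> (forall z, E z -> v z <= M) ->
  wnorm E v (c *: P) = cmod c * wnorm E v P.
Proof.
move=> Eb v0 vM; have [->|c0] := eqVneq c 0.
  rewrite cmod0 mul0r scale0r; apply/eqP; rewrite eq_le (wnorm_ge0 Eb v0 vM) andbT.
  by apply: wnorm_le => // z _; rewrite horner0 cmod0 mulr0.
apply: le_anti; rewrite (wnormZ Eb v0 vM)/=.
rewrite -ler_pdivlMl ?cmod_gt0// -cmodV.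
by rewrite -{1}(scalerK c0 P) (wnormZ Eb v0 vM).
Qed.

Lemma wnorm_fibre_le Q : Q \is monic -> size Q = (n * m).+1 ->
  exists U : {poly cplx R}, [/\ U \is monic, size U = n.+1 &
    wnorm L w U <= cmod a ^+ n * wnorm K wK Q].
Proof.
move=> Qm sQ; have [Qt [sQt cQt hQt]] := fibre_sum hp hm sQ.
move: cQt; rewrite (monicP Qm) mulr1 => cQt.
have m0 : (m%:R : cplx R) != 0 by rewrite pnatr_eq0 -lt0n.
have an0 : a ^+ n != 0 by rewrite expf_neq0.
(* [Qt] has leading coefficient m / a^n, so [U] is the fibre average rescaled to be monic. *)
pose U := (a ^+ n / m%:R) *: Qt.
have Un : U`_n = 1.
  by rewrite coefZ mulrAC [_ * Qt`_n]mulrC cQt mulfV.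
have sU : size U = n.+1.
  apply/eqP; rewrite eqn_leq (leq_trans (size_scale_leq _ _))//= ltnNge.
  by apply/negP => /(nth_default 0)/eqP; rewrite Un oner_eq0.
exists U; split => //; first by rewrite monicE lead_coefE sU Un.
have wK0 z : K z -> 0 <= wK z by exact: w_ge0.
have wKM z : K z -> wK z <= M by exact: w_le.
apply: wnorm_le => [|u Lu].
  by rewrite mulr_ge0 ?exprn_ge0 ?cmod_ge0// (wnorm_ge0 Kb wK0 wKM).
rewrite hornerZ cmodM cmodM cmodV cmodX cmod_nat mulrCA -!mulrA.
rewrite ler_wpM2l ?exprn_ge0 ?cmod_ge0// ler_pdivrMl ?ltr0n//.
have [rs prs srs] := poly_fibre u.
rewrite -(hQt _ _ prs) (le_trans (ler_wpM2l (w_ge0 Lu) (cmod_sum _ _ _)))//.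
rewrite mulr_sumr mulr_natl -srs.
(* The factor m is turned into a constant sum over the fibre [rs], to be compared term by term. *)
rewrite -[leRHS]addr0 -iter_addr -count_predT -big_const_seq.
rewrite big_seq [leRHS]big_seq ler_sum// => z zrs.
rewrite -(fibre_root prs zrs) -/(wK z).
by apply: (wnorm_ub Kb wK0 wKM); rewrite /K /= (fibre_root prs zrs).
Qed.

Lemma is_chebyshev_comp T : is_chebyshev L w n T ->
  is_chebyshev K wK (n * m) ((a ^+ n)^-1 *: (T \Po p)).
Proof.
move=> [Tm sT Tmin]; have an0 : (a ^+ n)^-1 != 0 by rewrite invr_eq0 expf_neq0.
have wK0 z : K z -> 0 <= wK z by exact: w_ge0.
have wKM z : K z -> wK z <= M by exact: w_le.
split.
- rewrite monicE lead_coefZ lead_coef_comp ?hp// (monicP Tm) mul1r sT /=.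
  by rewrite mulVf// expf_neq0.
- have Tp0 : T \Po p != 0.
    by rewrite -lead_coef_eq0 lead_coef_comp ?hp// (monicP Tm) mul1r expf_neq0.
  by rewrite size_scale// -(prednK (_ : 0 < size (T \Po p))%N) ?size_poly_gt0// size_comp_poly sT hp.
move=> Q Qm sQ; have [U [Um sU hU]] := wnorm_fibre_le Qm sQ.
rewrite (wnorm_scale _ _ Kb wK0 wKM) wnorm_comp cmodV cmodX.
rewrite ler_pdivrMl ?exprn_gt0 ?cmod_gt0//.
exact: le_trans (Tmin _ Um sU) hU.
Qed.

Lemma chebyshev_comp T : is_chebyshev L w n T -> 0 < wnorm L w T ->
  [/\ chebyshev L w n = T,
      chebyshev K wK (n * m) = (a ^+ n)^-1 *: (T \Po p) &
      cheb_norm K wK (n * m) = cheb_norm L w n / cmod (a ^+ n)].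
Proof.
move=> hT T0.
have wK0 z : K z -> 0 <= wK z by exact: w_ge0.
have wKM z : K z -> wK z <= M by exact: w_le.
have E1 : chebyshev L w n = T.
  apply: xget_unique => // P hP; apply/esym.
  exact: (is_chebyshev_unique Lb w_ge0 w_le T0 hT hP).
have hK := is_chebyshev_comp hT.
have NE : wnorm K wK ((a ^+ n)^-1 *: (T \Po p)) = wnorm L w T / cmod (a ^+ n).
  by rewrite (wnorm_scale _ _ Kb wK0 wKM) wnorm_comp cmodV mulrC.
have E2 : chebyshev K wK (n * m) = (a ^+ n)^-1 *: (T \Po p).
  apply: xget_unique => // P hP; apply/esym.
  apply: (is_chebyshev_unique Kb wK0 wKM _ hK hP).
  by rewrite NE divr_gt0// cmod_gt0 expf_neq0.
by split => //; rewrite /cheb_norm E1 E2 NE.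
Qed.

End Composition.

(** * Borel functions with complex values *)

Section BorelPlane.
Variable R : realType.
Local Notation C := (cplx R).
Local Notation B := (borel_cplx R).

Lemma open_borel (U : set C) : open U -> measurable (U : set B).
Proof. by move=> oU; apply: sub_sigma_algebra. Qed.

Lemma closed_borel (U : set C) : closed U -> measurable (U : set B).
Proof.
by move=> cU; rewrite -[U]setCK; apply: measurableC; apply: open_borel; exact: closed_openC.
Qed.

Lemma ball_cmod (z : C) (r : R) : ball z (r%:C)%C = [set u | cmod (z - u) < r].
Proof.
by rewrite -ball_normE; apply/seteqP; split=> u /=; rewrite cmod_norm ltcR.
Qed.

(** Balls of [cplx R] have complex radii; a positive complex number is real, so real radii
    suffice. *)
Lemma open_cmodP (U : set C) : open U <->
  forall z, U z -> exists2 r : R, 0 < r & forall u, cmod (z - u) < r -> U u.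
Proof.
split=> [oU z Uz|H].
  have : nbhs z U by exact: open_nbhs_nbhs.
  move=> /nbhs_ballP[e /= e0 eU]; exists (complex.Re e).
    by move: e0; rewrite ltcE => /andP[].
  move=> u zu; apply: eU; rewrite -(RRe_real (gtr0_real e0)) ball_cmod//.
rewrite openE => z /H[r r0 hr]; apply/nbhs_ballP; exists (r%:C)%C => /=.
  by rewrite ltcR.
by move=> u; rewrite ball_cmod /= => /hr.
Qed.

Definition ratC (q : rat * rat) : C := Complex (ratr q.1) (ratr q.2).

(** The one-sided bounds on real and imaginary parts serve the quarter-plane tests of
    [measurable_root_set]. *)
Lemma ratC_dense (z : C) (e : R) : 0 < e ->
  exists q, [/\ cmod (z - ratC q) < e, complex.Re (ratC q) < complex.Re z + e
    & complex.Im (ratC q) < complex.Im z + e].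
Proof.
case: z => a b e0; have e4 : 0 < e / 4 by rewrite divr_gt0.
have [q1] := rat_in_itvoo (ltr_pwDr e4 (lexx a)).
have [q2] := rat_in_itvoo (ltr_pwDr e4 (lexx b)).
rewrite !in_itv /= => /andP[h3 h4] /andP[h1 h2]; exists (q1, q2); split; last 2 first.
- by rewrite /=; lra.
- by rewrite /=; lra.
apply: le_lt_trans (cmod_le_ReIm (Complex a b - ratC (q1, q2))) _ => /=; rewrite ltr0_norm; last lra.
rewrite ltr0_norm; lra.
Qed.

Lemma measurable_ReB : measurable_fun setT (@complex.Re R : B -> R).
Proof.
apply: (measurability _ (RGenOpens.measurableE R)) => _ [_ [a [b ->] <-]]; rewrite setTI.
apply: open_borel; apply/open_cmodP => z /= /[!in_itv] /= /andP[az zb].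
exists (Num.min (complex.Re z - a) (b - complex.Re z)).
  by rewrite lt_min !subr_gt0 az.
move=> u; rewrite lt_min => /andP[h1 h2].
have := le_lt_trans (Re_le_cmod _) h1; have := le_lt_trans (Re_le_cmod _) h2.
case: z u {h1 h2 az zb} => z z' [u u'] /=; rewrite !ltr_norml in_itv /=; lra.
Qed.

Lemma measurable_ImB : measurable_fun setT (@complex.Im R : B -> R).
Proof.
apply: (measurability _ (RGenOpens.measurableE R)) => _ [_ [a [b ->] <-]]; rewrite setTI.
apply: open_borel; apply/open_cmodP => z /= /[!in_itv] /= /andP[az zb].
exists (Num.min (complex.Im z - a) (b - complex.Im z)).
  by rewrite lt_min !subr_gt0 az.
move=> u; rewrite lt_min => /andP[h1 h2].
have := le_lt_trans (Im_le_cmod _) h1; have := le_lt_trans (Im_le_cmod _) h2.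
case: z u {h1 h2 az zb} => z z' [u u'] /=; rewrite !ltr_norml in_itv /=; lra.
Qed.

Section Param.
Context d (T : measurableType d).
Implicit Types f g : T -> B.

(** The sigma-algebra is generated by open sets, and an open set is a countable union of balls with
    rational centre and radius. The preimage of such a ball is a quadratic inequality in the real
    and imaginary parts of f. *)
Lemma measurable_cplxP f : measurable_fun setT (@complex.Re R \o f) ->
  measurable_fun setT (@complex.Im R \o f) -> measurable_fun setT f.
Proof.
move=> mRe mIm.
have mball q (r : R) : measurable [set t | cmod (ratC q - f t) < r].
  have [r0|r0] := leP r 0.
    rewrite (_ : [set _ | _] = set0)//; apply/seteqP; split => // t /=.
    by move=> /lt_le_trans/(_ r0); rewrite ltNge cmod_ge0.
  rewrite (_ : [set _ | _] = [set t | (complex.Re (ratC q) - (@complex.Re R \o f) t) ^+ 2 +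
      (complex.Im (ratC q) - (@complex.Im R \o f) t) ^+ 2 < r ^+ 2]); last first.
    have E t : cmod (ratC q - f t) < r = ((complex.Re (ratC q) - (@complex.Re R \o f) t) ^+ 2 +
      (complex.Im (ratC q) - (@complex.Im R \o f) t) ^+ 2 < r ^+ 2).
      rewrite -(ltr_pXn2r (n := 2)) ?nnegrE ?cmod_ge0 ?(ltW r0)//.
      by rewrite cmod_sqr /comp; case: (f t).
    by apply/seteqP; split => t; rewrite /mkset E.
  rewrite -[X in measurable X]setTI; apply: measurable_fun_ltr => //.
  by apply: measurable_funD; apply: measurable_funX; exact: measurable_funB.
apply: (@measurability _ _ _ _ setT f (@open C)) => // _ [U oU <-]; rewrite setTI.
pose F (i : rat * rat * rat) := [set t | cmod (ratC i.1 - f t) < ratr i.2 /\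
   forall u : C, cmod (ratC i.1 - u) < ratr i.2 -> U u].
rewrite (_ : _ @^-1` _ = \bigcup_i F i); last first.
  apply/seteqP; split => [t /= Uft|t [[q r] _ [/= h1 h2]]]; last exact: h2.
  have [r r0 hr] := (open_cmodP U).1 oU _ Uft.
  (* With the centre q within r / 3 of [f t] and a radius s between r / 3 and 2 r / 3, the ball
     contains [f t] and stays within distance r of it. *)
  have r3 : 0 < r / 3 by rewrite divr_gt0.
  have [q [hq _ _]] := ratC_dense (f t) r3.
  have [s] := rat_in_itvoo (ltr_pwDr r3 (lexx (r / 3))).
  rewrite in_itv /= => /andP[s1 s2]; exists (q, s) => //; split => /=.
    by rewrite cmodBC (lt_trans hq).
  move=> u hu; apply: hr.
  have := cmodD (f t - ratC q) (ratC q - u).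
  rewrite addrA subrK; lra.
apply: countable_bigcupT_measurable => [|[q s]]; first exact: countableP.
have [H|H] := pselect (forall u : C, cmod (ratC q - u) < ratr s -> U u).
  rewrite (_ : F _ = [set t | cmod (ratC q - f t) < ratr s])//.
  by apply/seteqP; split => t // [].
rewrite (_ : F _ = set0)//; by apply/seteqP; split => t // [].
Qed.

Lemma measurable_cRe f : measurable_fun setT f -> measurable_fun setT (fun t => complex.Re (f t)).
Proof. by move=> mf; apply: measurableT_comp => //; exact: measurable_ReB. Qed.

Lemma measurable_cIm f : measurable_fun setT f -> measurable_fun setT (fun t => complex.Im (f t)).
Proof. by move=> mf; apply: measurableT_comp => //; exact: measurable_ImB. Qed.

Lemma measurable_cD f g : measurable_fun setT f -> measurable_fun setT g ->
  measurable_fun setT (fun t => (f t : C) + g t : B).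
Proof.
move=> mf mg; apply: measurable_cplxP.
  rewrite (_ : _ \o _ = (fun t => complex.Re (f t) + complex.Re (g t))).
    by apply: measurable_funD; exact: measurable_cRe.
  by apply/funext => t /=; case: (f t); case: (g t).
rewrite (_ : _ \o _ = (fun t => complex.Im (f t) + complex.Im (g t))).
  by apply: measurable_funD; exact: measurable_cIm.
by apply/funext => t /=; case: (f t); case: (g t).
Qed.

Lemma measurable_cM f g : measurable_fun setT f -> measurable_fun setT g ->
  measurable_fun setT (fun t => (f t : C) * g t : B).
Proof.
move=> mf mg; apply: measurable_cplxP.
  rewrite (_ : _ \o _ = (fun t => complex.Re (f t) * complex.Re (g t) -
     complex.Im (f t) * complex.Im (g t))).
    by apply: measurable_funB; apply: measurable_funM;
      (exact: measurable_cRe || exact: measurable_cIm).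
  by apply/funext => t /=; case: (f t); case: (g t).
rewrite (_ : _ \o _ = (fun t => complex.Re (f t) * complex.Im (g t) +
     complex.Im (f t) * complex.Re (g t))).
  by apply: measurable_funD; apply: measurable_funM;
      (exact: measurable_cRe || exact: measurable_cIm).
by apply/funext => t /=; case: (f t); case: (g t).
Qed.

Lemma measurable_cB f g : measurable_fun setT f -> measurable_fun setT g ->
  measurable_fun setT (fun t => (f t : C) - g t : B).
Proof.
move=> mf mg; rewrite (_ : (fun t => _) = (fun t => (f t : C) + ((-1 : C) * g t))).
  by apply: measurable_cD => //; apply: measurable_cM.
by apply/funext => t; rewrite mulN1r.
Qed.

Lemma measurable_csum (I : Type) (s : seq I) (F : I -> T -> B) :
  (forall i, measurable_fun setT (F i)) ->
  measurable_fun setT (fun t => \sum_(i <- s) (F i t : C) : B).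
Proof.
move=> mF; elim: s => [|i s IH].
  by rewrite (_ : (fun t => _) = fun=> 0)//; apply/funext => t; rewrite big_nil.
rewrite (_ : (fun t => _) = (fun t => (F i t : C) + \sum_(j <- s) (F j t : C))).
  by apply: measurable_cD.
by apply/funext => t; rewrite big_cons.
Qed.

Lemma measurable_cX f k : measurable_fun setT f ->
  measurable_fun setT (fun t => (f t : C) ^+ k : B).
Proof.
move=> mf; elim: k => [|k IH]; first by rewrite (_ : (fun t => _) = fun=> 1).
rewrite (_ : (fun t => _) = (fun t => (f t : C) * ((f t : C) ^+ k))).
  exact: measurable_cM.
by apply/funext => t; rewrite exprS.
Qed.

Lemma measurable_cmod f : measurable_fun setT f ->
  measurable_fun setT (fun t => cmod (f t)).
Proof.
move=> mf; rewrite (_ : (fun t => _) =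
    (fun t => Num.sqrt (complex.Re (f t) ^+ 2 + complex.Im (f t) ^+ 2))).
  apply: (measurableT_comp (f := @Num.sqrt R)).
    by apply: continuous_measurable_fun; exact: sqrt_continuous.
  by apply: measurable_funD; apply: measurable_funX;
    (exact: measurable_cRe || exact: measurable_cIm).
by apply/funext => t; case: (f t).
Qed.

Lemma measurable_horner (P : T -> {poly C}) f k :
  (forall t, (size (P t) <= k)%N) ->
  (forall i, measurable_fun setT (fun t => (P t)`_i : B)) ->
  measurable_fun setT f -> measurable_fun setT (fun t => (P t).[f t] : B).
Proof.
move=> sP mP mf.
rewrite (_ : (fun t => _) = (fun t => \sum_(i < k) (P t)`_i * (f t : C) ^+ i)).
  by apply: measurable_csum => i; apply: measurable_cM => //; exact: measurable_cX.
by apply/funext => t; rewrite (horner_coef_wide _ (sP t)).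
Qed.

End Param.

Lemma measurable_poly (p : {poly C}) : measurable_fun setT (fun z : B => p.[z] : B).
Proof.
by apply: (@measurable_horner _ _ (fun=> p) id (size p)) => // t.
Qed.

End BorelPlane.

(** * Measurable choice of the roots *)

Section MeasurableRoots.
Variable R : realType.
Local Notation C := (cplx R).
Local Notation B := (borel_cplx R).

Lemma prod_lt_exists (F : C -> R) (e : R) (s : seq C) : 0 < e ->
  (forall z, 0 <= F z) -> \prod_(z <- s) F z < e ^+ size s ->
  exists2 z, z \in s & F z < e.
Proof.
move=> e0 F0; elim: s => [|z s IH]; first by rewrite big_nil expr0 ltxx.
rewrite big_cons exprS => H; have [Fz|Fz] := ltP (F z) e.
  by exists z => //; rewrite mem_head.
have [|u us Fu] := IH; last by exists u => //; rewrite inE us orbT.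
rewrite -(ltr_pM2l e0) (le_lt_trans _ H)// ler_wpM2r// prodr_ge0//.
Qed.

Lemma seq_min_pos (g : C -> R) (s : seq C) : (forall z, z \in s -> 0 < g z) ->
  exists2 e : R, 0 < e & forall z, z \in s -> e <= g z.
Proof.
elim: s => [|z s IH] H; first by exists 1.
have [u us|e e0 he] := IH; first by apply: H; rewrite inE us orbT.
exists (Num.min e (g z)); first by rewrite lt_min e0 H ?mem_head.
by move=> u; rewrite inE ge_min => /predU1P[->|/he->//]; rewrite lexx orbT.
Qed.

Lemma seq_argmin (g : C -> R) (Q : pred C) (s : seq C) : has Q s ->
  exists z, [/\ z \in s, Q z & forall u, u \in s -> Q u -> g z <= g u].
Proof.
elim: s => [//|z s IH] /=; have [/IH[u [us Qu umin]] _|nQ] := boolP (has Q s).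
  have [/andP[Qz zu]|H] := boolP (Q z && (g z <= g u)).
    exists z; rewrite mem_head; split => // v; rewrite inE => /predU1P[->//|vs Qv].
    exact: le_trans zu (umin _ vs Qv).
  exists u; rewrite inE us orbT; split => // v; rewrite inE => /predU1P[->|/umin//] Qz.
  by move: H; rewrite Qz /= -ltNge => /ltW.
rewrite orbF => Qz; exists z; rewrite mem_head; split => // v.
rewrite inE => /predU1P[->//|vs Qv]; exfalso; move/negP: nQ; apply.
by apply/hasP; exists v.
Qed.

Lemma root_continuity (p : {poly C}) z (e : R) : root p z -> 0 < e ->
  exists2 r : R, 0 < r & forall q, cmod (z - q) < r -> cmod p.[q] < e.
Proof.
move=> /factor_theorem[Q ->] e0.
have Eb : cbounded [set q : C | cmod (z - q) < 1].
  exists (1 + cmod z) => [|q /= H]; first by rewrite addr_ge0 ?cmod_ge0.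
  have := cmodD (q - z) z; rewrite subrK cmodBC; lra.
have [b b0 hb] := horner_cbounded Q Eb.
have d0 : 0 < e / (b + 1) by rewrite divr_gt0// ltr_wpDl.
exists (Num.min 1 (e / (b + 1))); first by rewrite lt_min ltr01.
move=> q; rewrite lt_min => /andP[q1 q2].
rewrite hornerM hornerXsubC cmodM (cmodBC q).
have := hb _ q1; have : e / (b + 1) * (b + 1) = e.
  by rewrite divfK// gt_eqF// ltr_wpDl.
have := cmod_ge0 Q.[q]; have := cmod_ge0 (z - q).
move: q2 d0; move: (e / _) (cmod _) (cmod _) => d x y *; nra.
Qed.

Context d (T : measurableType d).

Lemma invS_pos n : 0 < n.+1%:R^-1 :> R.
Proof. by rewrite invr_gt0. Qed.

Lemma invS_lt (e : R) : 0 < e -> exists n, n.+1%:R^-1 < e.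
Proof.
move=> e0; exists (Num.truncn e^-1); rewrite invf_plt ?posrE//.
exact: truncnS_gt.
Qed.

Variables (k : nat) (P : T -> {poly C}).
Hypotheses (Pm : forall t, P t \is monic) (sP : forall t, size (P t) = k.+1)
  (mP : forall i, measurable_fun setT (fun t => (P t)`_i : B)).

Let Proots t : {rs : seq C | P t = \prod_(z <- rs) ('X - z%:P) & size rs = k}.
Proof.
have [rs prs] := poly_roots (P t); rewrite (monicP (Pm t)) scale1r in prs.
by exists rs => //; apply/eqP; rewrite -eqSS -(sP t) prs size_prod_XsubC.
Qed.

Let Prootsin t rs z : P t = \prod_(z <- rs) ('X - z%:P) -> (z \in rs) = root (P t) z.
Proof. by move=> ->; rewrite root_prod_XsubC. Qed.

(** The uncountable quantifier over z becomes countable: for each n some rational point lies almost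
    in the quarter-plane and has |P(q)| < (1 / (n + 1))^k. As |P(q)| is the product of k distances
    to roots, some root is then within 1 / (n + 1) of q. The bounds depend on t because the choice
    of the imaginary part is constrained by the least real part. *)
Lemma measurable_root_set (al be : T -> R) : measurable_fun setT al ->
  measurable_fun setT be -> measurable [set t | exists z,
    [/\ root (P t) z, complex.Re z <= al t & complex.Im z <= be t]].
Proof.
move=> mal mbe.
pose F n (q : rat * rat) := [set t | complex.Re (ratC R q) < al t + n.+1%:R^-1] `&`
  [set t | complex.Im (ratC R q) < be t + n.+1%:R^-1] `&`
  [set t | cmod (P t).[ratC R q] < n.+1%:R^-1 ^+ k].
rewrite (_ : [set t | _] = \bigcap_n \bigcup_q F n q); last first.
  apply/seteqP; split => t.
    move=> [z [rz za zb]] n _.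
    have [e e0 he] := root_continuity rz (exprn_gt0 k (invS_pos n)).
    have m0 : 0 < Num.min e n.+1%:R^-1 by rewrite lt_min e0 invS_pos.
    have [q [q1 q2 q3]] := ratC_dense z m0; exists q => //.
    move: q1 q2 q3; set m := Num.min _ _ => q1 /= q2 q3.
    have me : m <= e by rewrite ge_min lexx.
    have mn : m <= n.+1%:R^-1 by rewrite ge_min lexx orbT.
    split; [split|] => /=; last by apply: he; exact: lt_le_trans me.
      exact: lt_le_trans q2 (lerD za mn).
    exact: lt_le_trans q3 (lerD zb mn).
  move=> H; have [rs prs srs] := Proots t.
  apply: contrapT => nex.
  (* [g z] is positive exactly when z misses the closed quarter-plane. The finitely many roots miss
     it by a common e, of which one half pays for the overshoot of q and the other for its distance
     to a root. *)
  pose g (z : C) := Num.max (complex.Re z - al t) (complex.Im z - be t).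
  have [z zrs|e e0 he] := @seq_min_pos g rs.
    rewrite /g lt_max !subr_gt0 !ltNge -negb_and; apply/negP => /andP[h1 h2].
    by apply: nex; exists z; split => //; rewrite -(Prootsin _ prs).
  have [n hn] : exists n, n.+1%:R^-1 < e / 2 by apply: invS_lt; rewrite divr_gt0.
  have [q _ [[/= h1 h2] h3]] := H n I.
  move: h3; rewrite prs horner_prod cmod_prod -srs.
  move=> /(@prod_lt_exists (fun z => cmod (('X - z%:P).[ratC R q]))).
  move=> /(_ (invS_pos n) (fun _ => cmod_ge0 _))[z zrs].
  rewrite hornerXsubC => zq; have := he _ zrs; rewrite /g leNgt => /negP; apply.
  have {zq} := (le_lt_trans (Re_le_cmod _) zq, le_lt_trans (Im_le_cmod _) zq).
  move: hn h1 h2; move: (n.+1%:R^-1) => dl; case: z {zrs} => x y /=.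
  move: (ratr q.1) (ratr q.2) (al t) (be t) => u v a1 b1 hd h1 h2.
  by rewrite !ltr_norml gt_max => -[]; lra.
apply: bigcapT_measurable => n; apply: countable_bigcupT_measurable.
  exact: countableP.
move=> q; apply: measurableI; first apply: measurableI.
- rewrite -[X in measurable X]setTI; apply: measurable_fun_ltr => //.
  exact: measurable_funD.
- rewrite -[X in measurable X]setTI; apply: measurable_fun_ltr => //.
  exact: measurable_funD.
rewrite -[X in measurable X]setTI; apply: measurable_fun_ltr => //.
apply: measurable_cmod; apply: (@measurable_horner _ _ _ P (fun=> ratC R q) k.+1) => //.
by move=> t; rewrite sP.
Qed.

Lemma measurable_fun_le_sets (f : T -> R) :
  (forall s, measurable [set t | f t <= s]) -> measurable_fun setT f.
Proof.
move=> H; apply: (measurability _ (RGenOInfty.measurableE R)) => _ [_ [a ->] <-].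
rewrite setTI (_ : _ @^-1` _ = ~` [set t | f t <= a]); first exact: measurableC.
by apply/seteqP; split => t /=; rewrite in_itv/= andbT ltNge => /negP.
Qed.

(* The root with least real part, and among those with least imaginary part. *)
Lemma measurable_root : (0 < k)%N ->
  exists2 r : T -> B, measurable_fun setT r & forall t, root (P t) (r t).
Proof.
move=> k0.
have lex t : exists xy : R * R, [/\ root (P t) (Complex xy.1 xy.2),
    forall z : C, root (P t) z -> xy.1 <= complex.Re z &
    forall z : C, root (P t) z -> complex.Re z <= xy.1 -> xy.2 <= complex.Im z].
  have [rs prs srs] := Proots t.
  have [|u [urs _ umin]] := @seq_argmin (@complex.Re R) xpredT rs.
    by rewrite has_predT srs.
  have [|v [vrs vu vmin]] := @seq_argmin (@complex.Im R)
      (fun z => complex.Re z <= complex.Re u) rs.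
    by apply/hasP; exists u.
  exists (complex.Re u, complex.Im v); split => /=.
  - have -> : complex.Re u = complex.Re v by apply: le_anti; rewrite umin.
    by rewrite -(Prootsin _ prs); case: (v) vrs.
  - by move=> z; rewrite -(Prootsin _ prs) => /umin; apply.
  by move=> z; rewrite -(Prootsin _ prs) => /vmin; apply.
have [xy hxy] := choice lex.
have mx : measurable_fun setT (fun t => (xy t).1).
  apply: measurable_fun_le_sets => s.
  (* The half-plane Re z <= s is exhausted by quarter-planes Im z <= N. *)
  rewrite (_ : [set t | _] = \bigcup_(N in [set: nat]) [set t | exists z,
    [/\ root (P t) z, complex.Re z <= s & complex.Im z <= N%:R]]).
    apply: bigcupT_measurable => N.
    by apply: (measurable_root_set (al := cst s) (be := cst N%:R)).
  apply/seteqP; split => t /=; have [h1 h2 h3] := hxy t.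
    move=> xs; exists (Num.truncn `|(xy t).2|).+1 => //.
    exists (Complex (xy t).1 (xy t).2); split => //=.
    exact: (le_trans (ler_norm _) (ltW (truncnS_gt _))).
  by move=> [N _ [z [rz zs _]]]; exact: le_trans (h2 _ rz) zs.
have my : measurable_fun setT (fun t => (xy t).2).
  apply: measurable_fun_le_sets => s.
  rewrite (_ : [set t | _] = [set t | exists z,
    [/\ root (P t) z, complex.Re z <= (xy t).1 & complex.Im z <= s]]).
    by apply: (measurable_root_set (be := cst s)).
  apply/seteqP; split => t /=; have [h1 h2 h3] := hxy t.
    by move=> ys; exists (Complex (xy t).1 (xy t).2).
  by move=> [z [rz zx zs]]; exact: le_trans (h3 _ rz zx) zs.
exists (fun t => Complex (xy t).1 (xy t).2); last by move=> t; have [] := hxy t.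
exact: measurable_cplxP.
Qed.

End MeasurableRoots.

(** Deflation: a measurable root is divided out, and the coefficients of the quotient are measurable
    by the Horner recursion [Qrec]. *)
Lemma measurable_roots (R : realType) d (T : measurableType d) k
    (P : T -> {poly cplx R}) :
  (forall t, P t \is monic) -> (forall t, size (P t) = k.+1) ->
  (forall i, measurable_fun setT (fun t => (P t)`_i : borel_cplx R)) ->
  exists2 r : nat -> T -> borel_cplx R, (forall i, measurable_fun setT (r i)) &
    forall t, P t = \prod_(i < k) ('X - (r i t : cplx R)%:P).
Proof.
elim: k P => [|k IH] P Pm sP mP.
  exists (fun _ _ => 0) => // t; rewrite big_ord0.
  have := Pm t; rewrite monicE lead_coefE sP /= => /eqP P1.
  by rewrite [LHS]size1_polyC ?sP// P1.
have [r0 mr0 rr0] := measurable_root Pm sP mP isT.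
pose Q t := P t %/ ('X - (r0 t : cplx R)%:P).
have PQ t : P t = Q t * ('X - (r0 t : cplx R)%:P).
  by apply/esym/divpK; rewrite dvdp_XsubCl.
have Qm t : Q t \is monic.
  by have := Pm t; rewrite {1}PQ monicMr ?monicXsubC.
have sQ t : size (Q t) = k.+1.
  by rewrite size_divp ?polyXsubC_eq0// size_XsubC sP subn1.
have Qrec t j : (Q t)`_j = (P t)`_j.+1 + r0 t * (Q t)`_j.+1.
  by rewrite [in RHS]PQ mulrBr coefB coefMX coefMC /= mulrC subrK.
(* The recursion runs downwards from the vanishing coefficients of index at least k + 1; i counts
   the steps taken. *)
have mQ i : forall j, (k.+1 <= j + i)%N ->
    measurable_fun setT (fun t => (Q t)`_j : borel_cplx R).
  elim: i => [|i IHi] j ji.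
    rewrite (_ : (fun t => _) = fun=> 0)//; apply/funext => t.
    by rewrite nth_default// sQ -[j]addn0.
  rewrite (_ : (fun t => _) = (fun t => (P t)`_j.+1 + r0 t * (Q t)`_j.+1)).
    apply: measurable_cD => //; apply: measurable_cM => //.
    by apply: IHi; rewrite addSnnS.
  by apply/funext => t; rewrite -Qrec.
have [r mr hr] := IH Q Qm sQ (fun j => mQ k.+1 j (leq_addl _ _)).
exists (fun i => if i is j.+1 then r j else r0) => [[]//|t].
by rewrite big_ord_recl /= PQ mulrC hr.
Qed.

(** * Logarithmic energies *)

Section GeneralIntegrals.
Context d (T : measurableType d) (R : realType) (mu : probability T R).
Local Open Scope ereal_scope.
Variable K : set T.
Hypotheses (mK : measurable K) (muK : mu K = 1).

Lemma probability_compl0 : mu (~` K) = 0.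
Proof. by rewrite probability_setC// muK subee. Qed.

Lemma ae_carrier (P : T -> Prop) : (forall t, K t -> P t) ->
  {ae mu, forall t, setT t -> P t}.
Proof.
move=> H; exists (~` K); split; first exact: measurableC.
  exact: probability_compl0.
by apply: subsetC => t Kt _; exact: H.
Qed.

Lemma ge0_integral_carrier (f : T -> \bar R) : measurable_fun setT f ->
  (forall t, 0 <= f t) -> \int[mu]_t f t = \int[mu]_(t in K) f t.
Proof.
move=> mf f0; rewrite (ge0_negligible_integral (N := ~` K))//.
- by rewrite setTD setCK.
- exact: measurableC.
- exact: probability_compl0.
Qed.

Lemma integral_carrier_eq (f g : T -> \bar R) : measurable_fun setT f ->
  measurable_fun setT g -> (forall t, K t -> f t = g t) ->
  \int[mu]_t f t = \int[mu]_t g t.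
Proof. by move=> mf mg fg; apply: ae_eq_integral => //; exact: ae_carrier. Qed.

Lemma ge0_integral_carrier_le (f g : T -> \bar R) : measurable_fun setT f ->
  measurable_fun setT g -> (forall t, 0 <= f t) -> (forall t, 0 <= g t) ->
  (forall t, K t -> f t <= g t) -> \int[mu]_t f t <= \int[mu]_t g t.
Proof.
move=> mf mg f0 g0 fg; apply: ae_ge0_le_integral => //; exact: ae_carrier.
Qed.

Lemma integral_carrier_cst (x : \bar R) : \int[mu]_(t in K) x = x.
Proof. by rewrite integral_cst// -[RHS]mule1; congr (_ * _). Qed.

Lemma integral_prob_cst (c : R) : \int[mu]_t c%:E = c%:E.
Proof.
rewrite integral_cst// -[RHS]mule1; congr (_ * _); exact: probability_setT.
Qed.

(** Linearity that includes an infinite integral of g: the negative part of g - c is at most |c|,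
    hence has finite integral, while its positive part plus |c| dominates g. *)
Lemma integral_subr (g : T -> \bar R) (c : R) : measurable_fun setT g ->
  (forall t, 0 <= g t) -> \int[mu]_t (g t - c%:E) = \int[mu]_t g t - c%:E.
Proof.
move=> mg g0; have mgc : measurable_fun setT (fun t => g t - c%:E).
  by apply: emeasurable_funB.
have ic : mu.-integrable setT (fun=> c%:E).
  exact: finite_measure_integrable_cst.
have [goo|] := ltP (\int[mu]_t g t) +oo.
  have ig : mu.-integrable setT g.
    by apply/integrableP; split => //; under eq_integral do rewrite gee0_abs//.
  by rewrite [LHS](integralB _ ig ic)// integral_prob_cst.
rewrite leye_eq => /eqP goo; rewrite goo addye//.
have hneg : \int[mu]_t (fun t => g t - c%:E)^\- t <= `|c|%:E.
  rewrite -[leRHS]integral_prob_cst; apply: ge0_le_integral => //.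
  - exact: measurable_funeneg.
  - move=> t _; rewrite funenegE ge_max lee_fin normr_ge0 andbT.
    have := g0 t; case: (g t) => [r|_|//].
      rewrite -EFinB -EFinN !lee_fin => r0.
      by rewrite opprB (le_trans _ (ler_norm c))// gerBl.
    by rewrite addye// leNye.
have hpos : \int[mu]_t (fun t => g t - c%:E)^\+ t = +oo.
  apply/eqP; rewrite -leye_eq leNgt; apply/negP => hlt.
  have : \int[mu]_t g t <= \int[mu]_t ((fun t => g t - c%:E)^\+ t + `|c|%:E).
    apply: ge0_le_integral => //.
    - by apply: emeasurable_funD => //; exact: measurable_funepos.
    - move=> t _; rewrite -leeBlDr// (le_trans (_ : _ <= g t - c%:E))//.
        by rewrite leeB// lee_fin ler_norm.
      by rewrite funeposE le_max lexx.
  rewrite goo ge0_integralD//; last exact: measurable_funepos.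
  rewrite integral_prob_cst leye_eq => /eqP H.
  by move: H hlt; case: (\int[mu]_t _).
rewrite integralE hpos addye//; apply: contraTneq hneg.
by case: (\int[mu]_t _).
Qed.

End GeneralIntegrals.

Section Kernel.
Variable R : realType.
Local Notation cC := (cplx R).
Local Notation B := (borel_cplx R).

(* The truncation at 0 is invisible on sets of diameter at most [expR C]; it
   makes the kernel nonnegative on the whole plane. *)
Definition kern (C : R) (z u : cC) : \bar R := (maxe 0 (log_kernel z u + C%:E))%E.

Definition potential (C : R) (mu : probability B R) (z : cC) : \bar R :=
  (\int[mu]_u kern C z u)%E.

Definition mutual_energy (C : R) (mu nu : probability B R) : \bar R :=
  (\int[mu]_z potential C nu z)%E.

Lemma log_kernel_diag (z : cC) : log_kernel z z = +oo%E.
Proof. by rewrite /log_kernel subrr cmod0 le0_lneNy. Qed.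

Lemma log_kernel_neq (z u : cC) : z != u -> log_kernel z u = (- ln (cmod (z - u)))%:E.
Proof. by move=> zu; rewrite /log_kernel lne_EFin// cmod_gt0 subr_eq0. Qed.

Lemma log_kernelC (z u : cC) : log_kernel z u = log_kernel u z.
Proof. by rewrite /log_kernel cmodBC. Qed.

Lemma kernC C z u : kern C z u = kern C u z.
Proof. by rewrite /kern log_kernelC. Qed.

Lemma kern_ge0 C z u : (0 <= kern C z u)%E.
Proof. by rewrite le_max lexx. Qed.

Lemma log_kernel_ge C (z u : cC) : cmod (z - u) <= expR C -> (- C%:E <= log_kernel z u)%E.
Proof.
have [->|zu] := eqVneq z u; first by rewrite log_kernel_diag leey.
move=> H; rewrite log_kernel_neq// lee_fin lerN2.
by rewrite -[leRHS]expRK ler_ln ?posrE ?expR_gt0// cmod_gt0 subr_eq0.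
Qed.

Lemma kernE C (z u : cC) : cmod (z - u) <= expR C -> kern C z u = (log_kernel z u + C%:E)%E.
Proof.
move=> /log_kernel_ge H; apply/max_idPr.
by rewrite -leeBlDr// sub0e.
Qed.

Lemma measurable_lneEFin : measurable_fun setT (fun r : R => lne r%:E).
Proof.
rewrite (_ : (fun r => _) = (fun r : R => if r <= 0 then -oo%E else (ln r)%:E))//.
apply: measurable_fun_ifT => //.
  by apply: measurable_fun_ler.
by apply/measurable_EFinP; exact: measurable_ln.
Qed.

Lemma measurable_log_kernel d (T : measurableType d) (f g : T -> B) :
  measurable_fun setT f -> measurable_fun setT g ->
  measurable_fun setT (fun t => log_kernel (f t) (g t)).
Proof.
move=> mf mg; apply: measurableT_comp => //.
apply: (measurableT_comp measurable_lneEFin).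
by apply: measurable_cmod; exact: measurable_cB.
Qed.

Lemma measurable_kern d (T : measurableType d) C (f g : T -> B) :
  measurable_fun setT f -> measurable_fun setT g ->
  measurable_fun setT (fun t => kern C (f t) (g t)).
Proof.
move=> mf mg; apply: measurable_maxe => //.
by apply: emeasurable_funD => //; exact: measurable_log_kernel.
Qed.

Lemma measurable_kernr C z : measurable_fun setT (fun u : B => kern C z u).
Proof. by apply: measurable_kern. Qed.

Lemma measurable_potential C (mu : probability B R) :
  measurable_fun setT (potential C mu : B -> \bar R).
Proof.
apply: (@measurable_fun_fubini_tonelli_F _ _ B B R mu (fun zu => kern C zu.1 zu.2)).
  by apply: measurable_kern.
by move=> x; exact: kern_ge0.
Qed.

Lemma potential_ge0 C mu z : (0 <= potential C mu z)%E.
Proof. by apply: integral_ge0 => u _; exact: kern_ge0. Qed.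

Lemma mutual_energy_ge0 C mu nu : (0 <= mutual_energy C mu nu)%E.
Proof. by apply: integral_ge0 => u _; exact: potential_ge0. Qed.

(** The kernel takes both signs, so the measurability half of Tonelli's theorem is applied to its
    positive and negative parts. *)
Lemma measurable_log_potential (mu : probability B R) :
  measurable_fun setT (fun z : B => \int[mu]_u log_kernel z u)%E.
Proof.
have mk : measurable_fun setT (fun zu : B * B => log_kernel zu.1 zu.2).
  exact: measurable_log_kernel.
rewrite (_ : (fun z => _) = (fun z : B => (\int[mu]_u (fun zu : B * B => log_kernel zu.1 zu.2)^\+ (z, u)) -
    \int[mu]_u (fun zu : B * B => log_kernel zu.1 zu.2)^\- (z, u))%E); last first.
  by apply/funext => z; rewrite integralE; congr (_ - _)%E; apply: eq_integral => u _;
    rewrite ?funeposE ?funenegE.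
apply: emeasurable_funB.
- by apply: measurable_fun_fubini_tonelli_F => //; exact: measurable_funepos.
- by apply: measurable_fun_fubini_tonelli_F => //; exact: measurable_funeneg.
Qed.

(** On a carrier of diameter at most [expR C] the truncation is inactive, and the shift by C
    integrates to C. This moves all further work to nonnegative integrands. *)
Lemma log_energyE (K : set cC) C (mu : probability B R) :
  measurable (K : set B) -> mu K = 1%E ->
  (forall z u, K z -> K u -> cmod (z - u) <= expR C) ->
  log_energy mu = (mutual_energy C mu mu - C%:E)%E.
Proof.
move=> mK muK KC.
rewrite -integral_subr; last 2 first.
- exact: measurable_potential.
- exact: potential_ge0.
apply: (integral_carrier_eq mK muK).
- exact: measurable_log_potential.
- by apply: emeasurable_funB => //; exact: measurable_potential.
move=> z Kz; rewrite -integral_subr; last 2 first.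
- exact: measurable_kernr.
- by move=> u; exact: kern_ge0.
apply: (integral_carrier_eq mK muK).
- exact: measurable_log_kernel.
- by apply: emeasurable_funB => //; exact: measurable_kernr.
by move=> u Ku; rewrite kernE ?KC// addeK.
Qed.

End Kernel.

(** * Positive definiteness of the logarithmic energy *)

Section LogSeries.
Variable R : realType.

(** The Taylor polynomial of [- ln (1 - x)] at 0. *)
Definition log_partial (N : nat) (x : R) : R := \sum_(j < N) x ^+ j.+1 / j.+1%:R.

Lemma log_partial_ge0 N x : 0 <= x -> 0 <= log_partial N x.
Proof.
by move=> x0; apply: sumr_ge0 => j _; rewrite divr_ge0// exprn_ge0.
Qed.

Lemma log_partial_nd x : 0 <= x -> nondecreasing_seq (log_partial ^~ x).
Proof.
move=> x0; apply/nondecreasing_seqP => N.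
by rewrite /log_partial big_ord_recr /= lerDl divr_ge0// exprn_ge0.
Qed.

(** The remainder F has derivative y^N / (1 - y) by the geometric sum. The mean value theorem gives
    F(x) = x c^N / (1 - c) with 0 < c < x, and this quotient increases with c. *)
Lemma log_partial_bound N x : 0 <= x < 1 ->
  0 <= - ln (1 - x) - log_partial N x <= x ^+ N / (1 - x).
Proof.
move=> /andP[x0 x1].
pose F (y : R) := - ln (1 - y) - log_partial N y.
pose f (y : R) := y ^+ N / (1 - y).
have geo (y : R) : y < 1 -> (1 - y)^-1 - \sum_(j < N) y ^+ j = f y.
  move=> y1; have n0 : 1 - y != 0 by rewrite gt_eqF// subr_gt0.
  apply: (mulIf n0); rewrite mulrBl mulVf// /f divfK//.
  have /esym := subrX1 y N; rewrite mulrC => H.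
  have -> : (\sum_(j < N) y ^+ j) * (1 - y) = - ((\sum_(j < N) y ^+ j) * (y - 1)) by ring.
  by rewrite H; ring.
have dF (y : R) : y < 1 -> is_derive y (1 : R) F (f y).
  move=> y1.
  have y1' : 0 < 1 - y by rewrite subr_gt0.
  have dl : is_derive y (1 : R) (fun y : R => ln (1 - y)) (- (1 - y)^-1).
    have := @is_derive1_comp R (@ln R) (fun y => 1 - y) y (1 - y)^-1 (-1).
    rewrite mulrN1; apply; first exact: is_derive1_ln.
    by rewrite -[X in is_derive _ _ _ X]sub0r; apply: is_deriveB.
  have dp : is_derive y (1 : R) (log_partial N) (\sum_(j < N) y ^+ j).
    rewrite (_ : log_partial N = \sum_(j < N) (fun y : R => y ^+ j.+1 / j.+1%:R)); last first.
      by apply/funext => u; rewrite fct_sumE.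
    apply: is_derive_sum => j.
    rewrite (_ : (fun u => _) = (j.+1%:R^-1 : R) \*: ((id : R -> R) ^+ j.+1)); last first.
      by apply/funext => u; rewrite /= exprfctE mulrC.
    apply: is_derive_eq; rewrite /= [_ *: 1]mulr1 -[_ *: _]/(_ * _).
    by rewrite mulrA mulVf ?mul1r.
  rewrite -(geo _ y1) -[(1 - y)^-1]opprK.
  by apply: is_deriveB; exact: is_deriveN.
have F0 : F 0 = 0.
  rewrite /F subr0 ln1 oppr0 sub0r /log_partial big1 ?oppr0// => j _.
  by rewrite expr0n mul0r.
rewrite -/(F x); have [->|xn0] := eqVneq x 0.
  by rewrite F0 lexx subr0 divr1 exprn_ge0.
have {}x0 : 0 < x by rewrite lt_def xn0.
have [||c /[!in_itv]/= /andP[c0 cx]] := MVT x0 (f := F) (df := f).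
- by move=> y /[!in_itv] /= /andP[_ yx]; apply: dF; exact: lt_trans x1.
- apply: derivable_within_continuous => y /[!in_itv] /= /andP[_ yx].
  by have [] := dF y (le_lt_trans yx x1).
rewrite F0 !subr0 => ->; rewrite /f.
have c1 : c < 1 by exact: lt_trans x1.
have H : c ^+ N / (1 - c) <= x ^+ N / (1 - x).
  rewrite ler_pM ?exprn_ge0 ?invr_ge0 ?subr_ge0 ?(ltW c0) ?(ltW c1)//.
    by rewrite lerXn2r ?nnegrE ?(ltW c0) ?(ltW x0)// ltW.
  by rewrite lef_pV2 ?posrE ?subr_gt0// lerB// ltW.
have fc : 0 <= c ^+ N / (1 - c) by rewrite divr_ge0 ?exprn_ge0 ?subr_ge0 ?ltW.
rewrite mulr_ge0 ?(ltW x0)//= (le_trans _ H)// ler_piMr// ltW//.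
Qed.

Lemma log_partial_cvg x : 0 <= x <= 1 ->
  (log_partial N x)%:E @[N --> \oo] --> (- lne (1 - x)%:E)%E.
Proof.
move=> /andP[x0]; rewrite le_eqVlt => /predU1P[->|x1].
  rewrite subrr le0_lneNy//=.
  (* At x = 1 the limit is +oo: the harmonic sums dominate the logarithm. *)
  have H N : ln (N.+1%:R) <= log_partial N (1 : R).
    elim: N => [|N IH]; first by rewrite ln1 log_partial_ge0.
    rewrite /log_partial big_ord_recr /= -/(log_partial N 1) expr1n div1r.
    have -> : (N.+2%:R : R) = N.+1%:R * (1 + N.+1%:R^-1).
      by rewrite mulrDr mulr1 divff// -natr1.
    rewrite lnM ?posrE// ?addr_gt0// ?invr_gt0//.
    by rewrite lerD// le_ln1Dx// (lt_le_trans (ltrN10 _))// invr_ge0.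
  apply/cvgeyPge => A; near=> N; rewrite lee_fin (le_trans _ (H N))//.
  rewrite -[leLHS]expRK ler_ln ?posrE ?expR_gt0//.
  rewrite (le_trans (_ : _ <= N%:R))//; first by near: N; exact: nbhs_infty_ger.
by rewrite ler_nat.
rewrite lne_EFin ?subr_gt0//; apply: cvg_EFin; first exact: nearW.
rewrite /comp /= -[X in _ --> X]subr0.
rewrite (_ : (fun N => _) = (fun N => - ln (1 - x) - (- ln (1 - x) - log_partial N x))); last first.
  by apply/funext => N; rewrite opprB addrC subrK.
apply: cvgB; first exact: cvg_cst.
apply: (@squeeze_cvgr _ _ _ _ (fun=> 0) (fun N => x ^+ N / (1 - x))); last 2 first.
- exact: cvg_cst.
- rewrite (_ : (fun N => _) = geometric (1 - x)^-1 x).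
    by apply: cvg_geometric; rewrite ger0_norm.
  by apply/funext => N; rewrite mulrC.
by apply: nearW => N; apply: log_partial_bound; rewrite x0.
Unshelve. all: by end_near. Qed.

End LogSeries.

(** * Positive definite kernels of finite rank *)

Section FeatureKernels.
Context d (T : measurableType d) (R : realType).

(** Positive definiteness is encoded by an explicit finite feature map; boundedness makes the
    features integrable against every probability. *)
Definition feature_kernel (k : T -> T -> R) := exists (I : finType) (phi : I -> T -> R),
  [/\ forall i, measurable_fun setT (phi i),
      forall i, exists b : R, forall t, `|phi i t| <= b &
      forall s t, k s t = \sum_i phi i s * phi i t].

Lemma feature_kernelD k l : feature_kernel k -> feature_kernel l ->
  feature_kernel (fun s t => k s t + l s t).
Proof.
move=> [I [phi [mphi bphi kE]]] [J [psi [mpsi bpsi lE]]].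
exists (I + J)%type, (fun ij => match ij with inl i => phi i | inr j => psi j end).
by split => [[]|[]|s t] //; rewrite big_sumType kE lE.
Qed.

(** The Schur product theorem: products of features are features of the product. *)
Lemma feature_kernelM k l : feature_kernel k -> feature_kernel l ->
  feature_kernel (fun s t => k s t * l s t).
Proof.
move=> [I [phi [mphi bphi kE]]] [J [psi [mpsi bpsi lE]]].
exists (I * J)%type, (fun ij t => phi ij.1 t * psi ij.2 t); split.
- by move=> [i j]; exact: measurable_funM.
- move=> [i j]; have [b hb] := bphi i; have [c hc] := bpsi j.
  by exists (b * c) => t; rewrite normrM ler_pM.
move=> s t; rewrite kE lE big_distrlr pair_big; apply: eq_bigr => -[i j] _ /=; ring.
Qed.

Lemma feature_kernelZ c k : 0 <= c -> feature_kernel k ->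
  feature_kernel (fun s t => c * k s t).
Proof.
move=> c0 [I [phi [mphi bphi kE]]]; exists I, (fun i t => Num.sqrt c * phi i t).
split.
- by move=> i; exact: measurable_funM.
- move=> i; have [b hb] := bphi i; exists (Num.sqrt c * b) => t.
  by rewrite normrM ger0_norm ?sqrtr_ge0// ler_wpM2l// sqrtr_ge0.
move=> s t; rewrite kE mulr_sumr; apply: eq_bigr => i _.
by rewrite mulrACA -expr2 sqr_sqrtr.
Qed.

Lemma feature_kernelX k n : feature_kernel k -> feature_kernel (fun s t => k s t ^+ n.+1).
Proof.
move=> hk; elim: n => [//|n IH].
rewrite (_ : (fun s t => _) = (fun s t => k s t * k s t ^+ n.+1)).
  exact: feature_kernelM.
by apply/funext => s; apply/funext => t; rewrite exprS.
Qed.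

Lemma feature_kernel0 : feature_kernel (fun _ _ => 0).
Proof. by exists 'I_0, (fun _ _ => 0); split => [[]|[]|s t] //; rewrite big_ord0. Qed.

Lemma feature_kernel_sum n (k : nat -> T -> T -> R) :
  (forall i, feature_kernel (k i)) -> feature_kernel (fun s t => \sum_(i < n) k i s t).
Proof.
move=> hk; elim: n => [|n IH].
  rewrite (_ : (fun s t => _) = (fun _ _ => 0)); first exact: feature_kernel0.
  by apply/funext => s; apply/funext => t; rewrite big_ord0.
rewrite (_ : (fun s t => _) = (fun s t => \sum_(i < n) k i s t + k n s t)).
  exact: feature_kernelD.
by apply/funext => s; apply/funext => t; rewrite big_ord_recr.
Qed.

Lemma measurable_feature_kernel k s : feature_kernel k -> measurable_fun setT (k s).
Proof.
move=> [I [phi [mphi _ kE]]].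
rewrite (_ : k s = (fun t => \sum_(i <- index_enum I) phi i s * phi i t)).
  elim: (index_enum I) => [|i r IH].
    by rewrite (_ : (fun t => _) = fun=> 0)//; apply/funext => t; rewrite big_nil.
  rewrite (_ : (fun t => _) =
      (fun t => phi i s * phi i t + \sum_(i <- r) phi i s * phi i t)).
    by apply: measurable_funD => //; exact: measurable_funM.
  by apply/funext => t; rewrite big_cons.
by apply/funext => t; rewrite kE.
Qed.

Variable K : set T.
Hypothesis mK : measurable K.

(** [m nu] is the vector of integrals of the features over [K]. Mutual energies become scalar
    products of such vectors, and the energy inequality becomes the nonnegativity of a sum of
    squares. *)
Lemma feature_kernel_integral k : feature_kernel k ->
  exists (I : finType) (m : probability T R -> I -> R) (phi : I -> T -> R),
  (forall i, measurable_fun setT (phi i)) /\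
  (forall nu : probability T R,
    (forall s, \int[nu]_(t in K) (k s t)%:E = (\sum_i phi i s * m nu i)%:E)%E /\
    forall mu : probability T R,
    (\int[mu]_(s in K) \int[nu]_(t in K) (k s t)%:E = (\sum_i m mu i * m nu i)%:E)%E).
Proof.
move=> [I [phi [mphi bphi kE]]].
have iphi (mu : probability T R) i : mu.-integrable K (EFin \o phi i).
  apply: measurable_bounded_integrable => //.
  - exact: (le_lt_trans (probability_le1 _ mK) (ltry _)).
  - exact: measurable_funTS.
  have [b hb] := bphi i; exists b; split; first exact: num_real.
  by move=> M bM t _; apply: le_trans (hb t) _; exact: ltW.
pose m (mu : probability T R) i := fine (\int[mu]_(t in K) (phi i t)%:E)%E.
have mE (mu : probability T R) i : (\int[mu]_(t in K) (phi i t)%:E = (m mu i)%:E)%E.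
  by rewrite fineK//; exact: (integrable_fin_num mK (iphi mu i)).
exists I, m, phi; split => // nu.
have E (f : I -> R) (mu : probability T R) : (\int[mu]_(t in K) (\sum_i f i * phi i t)%:E = (\sum_i f i * m mu i)%:E)%E.
  transitivity (\int[mu]_(t in K) (\sum_i ((f i)%:E * (phi i t)%:E)))%E.
    by apply: eq_integral => t _; rewrite -sumEFin; apply: eq_bigr => i _; rewrite EFinM.
  rewrite integral_sum//; last by move=> i; apply: (integrableZl mK (f i) (iphi mu i)).
  rewrite -sumEFin; apply: eq_bigr => i _.
  by rewrite (integralZl mK (iphi mu i)) mE EFinM.
have E1 s : (\int[nu]_(t in K) (k s t)%:E = (\sum_i phi i s * m nu i)%:E)%E.
  by rewrite -E; apply: eq_integral => t _; rewrite kE.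
split=> // mu; under eq_integral do rewrite E1.
transitivity (\int[mu]_(t in K) (\sum_i m nu i * phi i t)%:E)%E.
  by apply: eq_integral => t _; congr EFin; apply: eq_bigr => i _; rewrite mulrC.
by rewrite E; congr EFin; apply: eq_bigr => i _; rewrite mulrC.
Qed.

Lemma feature_kernel_energy k (mu nu : probability T R) : feature_kernel k ->
  (\int[mu]_(s in K) \int[nu]_(t in K) (k s t)%:E +
   \int[mu]_(s in K) \int[nu]_(t in K) (k s t)%:E <=
   \int[mu]_(s in K) \int[mu]_(t in K) (k s t)%:E +
   \int[nu]_(s in K) \int[nu]_(t in K) (k s t)%:E)%E.
Proof.
move=> /feature_kernel_integral[I [m [phi [_ H]]]].
rewrite !(H _).2 -!EFinD lee_fin -!big_split /=; apply: ler_sum => i _.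
have := sqr_ge0 (m mu i - m nu i); nra.
Qed.

Lemma measurable_feature_integral k (nu : probability T R) : feature_kernel k ->
  measurable_fun setT (fun s => \int[nu]_(t in K) (k s t)%:E)%E.
Proof.
move=> /feature_kernel_integral[I [m [phi [mphi H]]]].
rewrite (_ : (fun s => _) = EFin \o (fun s => \sum_(i <- index_enum I) phi i s * m nu i)).
  apply/measurable_EFinP; elim: (index_enum I) => [|i r IH].
    by rewrite (_ : (fun t => _) = fun=> 0)//; apply/funext => t; rewrite big_nil.
  rewrite (_ : (fun t => _) =
      (fun t => phi i t * m nu i + \sum_(i <- r) phi i t * m nu i)).
    by apply: measurable_funD => //; exact: measurable_funM.
  by apply/funext => t; rewrite big_cons.
by apply/funext => s; rewrite (H nu).1.
Qed.

(** Monotone convergence, in the inner and then in the outer integral. The kernels are nonnegative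
    and increasing on [K] only, whence the integrals over [K]. *)
Lemma limit_kernel_energy (k : nat -> T -> T -> R) (l : T -> T -> \bar R)
    (mu nu : probability T R) :
  (forall N, feature_kernel (k N)) ->
  (forall N s t, K s -> K t -> 0 <= k N s t) ->
  (forall s t, K s -> K t -> nondecreasing_seq (fun N => k N s t)) ->
  (forall s t, K s -> K t -> (k N s t)%:E @[N --> \oo] --> l s t) ->
  (\int[mu]_(s in K) \int[nu]_(t in K) l s t +
   \int[mu]_(s in K) \int[nu]_(t in K) l s t <=
   \int[mu]_(s in K) \int[mu]_(t in K) l s t +
   \int[nu]_(s in K) \int[nu]_(t in K) l s t)%E.
Proof.
move=> fk k0 knd kl.
have inner (m : probability T R) s : K s ->
    (\int[m]_(t in K) (k N s t)%:E)%E @[N --> \oo] --> (\int[m]_(t in K) l s t)%E.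
  move=> Ks.
  rewrite (_ : (\int[m]_(t in K) l s t = \int[m]_(t in K) (limn (fun N => (k N s t)%:E)))%E); last first.
    by apply: eq_integral => t /[!inE] Kt; apply/esym/cvg_lim => //; exact: kl.
  apply: cvg_monotone_convergence => //.
  - move=> N; apply/measurable_EFinP; apply: measurable_funTS.
    exact: measurable_feature_kernel.
  - by move=> N t Kt; rewrite lee_fin k0.
  - by move=> t Kt M N MN; rewrite lee_fin; exact: knd.
have in0 (m : probability T R) N s : K s -> (0 <= \int[m]_(t in K) (k N s t)%:E)%E.
  by move=> Ks; apply: integral_ge0 => t Kt; rewrite lee_fin k0.
have innd (m : probability T R) s : K s ->
    nondecreasing_seq (fun N => \int[m]_(t in K) (k N s t)%:E)%E.
  move=> Ks M N MN; apply: ge0_le_integral => //.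
  - by move=> t Kt; rewrite lee_fin k0.
  - by apply/measurable_EFinP; apply: measurable_funTS; exact: measurable_feature_kernel.
  - by apply/measurable_EFinP; apply: measurable_funTS; exact: measurable_feature_kernel.
  - by move=> t Kt; rewrite lee_fin; exact: knd.
have outer (m n : probability T R) :
    (\int[m]_(s in K) \int[n]_(t in K) (k N s t)%:E)%E @[N --> \oo] -->
    (\int[m]_(s in K) \int[n]_(t in K) l s t)%E.
  rewrite (_ : (\int[m]_(s in K) \int[n]_(t in K) l s t =
      \int[m]_(s in K) (limn (fun N => \int[n]_(t in K) (k N s t)%:E)))%E); last first.
    by apply: eq_integral => s /[!inE] Ks; apply/esym/cvg_lim => //; exact: inner.
  apply: cvg_monotone_convergence => //.
  - by move=> N; apply: measurable_funTS; exact: measurable_feature_integral.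
  - by move=> N s Ks; exact: in0.
  - by move=> s Ks; exact: innd.
have out0 (m n : probability T R) : (0 <= \int[m]_(s in K) \int[n]_(t in K) l s t)%E.
  apply: integral_ge0 => s Ks; apply: integral_ge0 => t Kt.
  rewrite -(cvg_lim _ (kl s t Ks Kt))//; apply: lime_ge.
    by apply/cvg_ex; exists (l s t); exact: kl.
  by apply: nearW => N; rewrite lee_fin k0.
have dd (x y : \bar R) : (0 <= x)%E -> (0 <= y)%E -> (x +? y)%E.
  by move=> x0 y0; exact: ge0_adde_def.
apply: (lee_cvg_to (cvgeD _ (outer mu nu) (outer mu nu)) (cvgeD _ (outer mu mu) (outer nu nu))).
- exact: dd.
- exact: dd.
by apply: nearW => N; exact: feature_kernel_energy.
Qed.

End FeatureKernels.

(** * The logarithmic kernel seen on the Riemann sphere *)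

Section PositiveDefinite.
Variable R : realType.
Local Notation cC := (cplx R).
Local Notation B := (borel_cplx R).
Variables (K : set cC) (rho C : R).
Hypotheses (mK : measurable (K : set B)) (rho1 : 1 <= rho)
  (Krho : forall z, K z -> cmod z <= rho) (C_ge : 2 * rho <= expR C).

(** The scale has to satisfy M^2 >= 8 rho^2: on [K] one has |z - u| <= 2 rho and h z h u >= M^4, so
    that [sph] is nonnegative there and the partial sums of the logarithmic series increase. *)
Let M := 3 * rho.
Let h (z : cC) := M ^+ 2 + cmod z ^+ 2.
Let phi0 (z : B) : R := (M ^+ 2 - cmod z ^+ 2) / h z.
Let phi1 (z : B) : R := 2 * M * complex.Re z / h z.
Let phi2 (z : B) : R := 2 * M * complex.Im z / h z.

(* Scalar product of the stereographic projections of z / M and u / M. *)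
Let sph (z u : B) := phi0 z * phi0 u + phi1 z * phi1 u + phi2 z * phi2 u.

Let M0 : 0 < M.
Proof. by rewrite /M; move: rho1 => *; lra. Qed.

Let h_gt0 z : 0 < h z.
Proof. by rewrite ltr_wpDr ?sqr_ge0// exprn_gt0. Qed.

Let h_ge1 z : 1 <= h z.
Proof.
by rewrite /h /M; have := sqr_ge0 (cmod z); move: rho1 => *; nra.
Qed.

(** The chordal distance formula. After taking logarithms, [- ln (1 - sph z u)] is twice the
    logarithmic kernel plus a constant and terms in z alone and in u alone. *)
Let sphE z u : 1 - sph z u = 2 * M ^+ 2 * cmod (z - u) ^+ 2 / (h z * h u).
Proof.
have hz := h_gt0 z; have hu := h_gt0 u.
have : h z != 0 by rewrite gt_eqF.
have : h u != 0 by rewrite gt_eqF.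
rewrite /sph /phi0 /phi1 /phi2 => hu0 hz0.
have E : cmod (z - u) ^+ 2 = cmod z ^+ 2 + cmod u ^+ 2 -
    2 * (complex.Re z * complex.Re u + complex.Im z * complex.Im u).
  rewrite !cmod_sqr; case: z {hz hz0} => a b; case: u {hu hu0} => c d /=; ring.
have F : complex.Re z ^+ 2 + complex.Im z ^+ 2 = cmod z ^+ 2 by rewrite cmod_sqr.
rewrite E; move: hz0 hu0; rewrite /h.
move: (cmod z) (cmod u) (complex.Re z) (complex.Re u) (complex.Im z) (complex.Im u) M.
by move=> *; field; apply/andP.
Qed.

Let sph_bound z u : K z -> K u -> 0 <= sph z u <= 1.
Proof.
move=> /Krho Kz /Krho Ku; have := sphE z u.
have h0 : 0 < h z * h u by rewrite mulr_gt0.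
have D0 : 0 <= 2 * M ^+ 2 * cmod (z - u) ^+ 2 / (h z * h u).
  by apply: divr_ge0; [apply: mulr_ge0; [apply: mulr_ge0 => //|]; exact: sqr_ge0|exact: ltW].
have D1 : 2 * M ^+ 2 * cmod (z - u) ^+ 2 / (h z * h u) <= 1.
  rewrite ler_pdivrMr// mul1r.
  have zu : cmod (z - u) ^+ 2 <= 4 * rho ^+ 2.
    have := le_trans (cmodB z u) (lerD Kz Ku); have := cmod_ge0 (z - u).
    move: rho1; move: (cmod _) => *; nra.
  apply: (@le_trans _ _ (M ^+ 2 * M ^+ 2)); last first.
    by rewrite ler_pM ?sqr_ge0// lerDl sqr_ge0.
  rewrite -mulrA mulrCA ler_wpM2l ?sqr_ge0// /M.
  have := sqr_ge0 rho; move: zu; move: (cmod _ ^+ 2) => *; nra.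
by move=> E; apply/andP; split; lra.
Qed.

Let mh : measurable_fun setT (h : B -> R).
Proof.
apply: measurable_funD => //; apply: measurable_funX.
exact: (measurable_cmod (f := @id B)).
Qed.

Let mhV : measurable_fun setT (fun z : B => (h z)^-1).
Proof.
rewrite (_ : (fun z => _) = (fun z : B => expR (- ln (h z)))).
  apply: (measurableT_comp (f := @expR R)) => //.
  by apply: measurable_funN; apply: (measurableT_comp (f := @ln R)) => //.
by apply/funext => z; rewrite expRN lnK ?posrE.
Qed.

Let phi_features : feature_kernel sph.
Proof.
have rank1 (f : B -> R) : measurable_fun setT f -> (forall z, `|f z| <= 1) ->
    feature_kernel (fun z u => f z * f u).
  move=> mf f1; exists unit, (fun _ => f); split => //.
    by move=> _; exists 1.
  by move=> z u; rewrite (big_pred1 tt)//; case.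
have S z : phi0 z ^+ 2 + phi1 z ^+ 2 + phi2 z ^+ 2 = 1.
  have := sphE z z; rewrite subrr cmod0 expr0n /= mulr0 mul0r /sph => /eqP.
  by rewrite subr_eq0 => /eqP/esym.
have b0 z : `|phi0 z| <= 1.
  rewrite -(ler_pXn2r (n := 2)) ?nnegrE// real_normK ?num_real// expr1n -(S z).
  by rewrite -addrA lerDl addr_ge0// sqr_ge0.
have b1 z : `|phi1 z| <= 1.
  rewrite -(ler_pXn2r (n := 2)) ?nnegrE// real_normK ?num_real// expr1n -(S z).
  by rewrite addrAC lerDr addr_ge0// sqr_ge0.
have b2 z : `|phi2 z| <= 1.
  rewrite -(ler_pXn2r (n := 2)) ?nnegrE// real_normK ?num_real// expr1n -(S z).
  by rewrite lerDr addr_ge0// sqr_ge0.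
apply: feature_kernelD; first apply: feature_kernelD; apply: rank1 => //.
- apply: measurable_funM => //; apply: measurable_funB => //.
  apply: measurable_funX; exact: (measurable_cmod (f := @id B)).
- apply: measurable_funM => //; apply: measurable_funM => //; exact: measurable_ReB.
- apply: measurable_funM => //; apply: measurable_funM => //; exact: measurable_ImB.
Qed.

(** Cancels the factor 2 M^2 of [sphE] and supplies the shift [C] of the two copies of [kern] in
    [kernE2]. *)
Let c := ln (2 * M ^+ 2) + 2 * C.

Let C0 : 0 <= C.
Proof. by rewrite -ler_expR expR0 (le_trans _ C_ge)//; move: rho1 => *; lra. Qed.

Let c0 : 0 <= c.
Proof.
rewrite addr_ge0 ?mulr_ge0// ln_ge0// /M.
by move: rho1 => *; nra.
Qed.

Let k N (z u : B) := log_partial N (sph z u) + c.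

Let k_features N : feature_kernel (k N).
Proof.
apply: feature_kernelD.
  apply: (@feature_kernel_sum _ _ _ N (fun j z u => sph z u ^+ j.+1 / j.+1%:R)) => j.
  rewrite (_ : (fun z u => _) = (fun z u => j.+1%:R^-1 * sph z u ^+ j.+1)).
    by apply: feature_kernelZ; [rewrite invr_ge0|exact: feature_kernelX].
  by apply/funext => z; apply/funext => u; rewrite mulrC.
(* A nonnegative constant is a kernel of rank one. *)
exists unit, (fun _ _ => Num.sqrt c); split => //.
  by move=> _; exists (Num.sqrt c) => _; rewrite ger0_norm// sqrtr_ge0.
by move=> z u; rewrite (big_pred1 tt) -?expr2 ?sqr_sqrtr//; case.
Qed.

Let kern_diam z u : K z -> K u -> cmod (z - u) <= expR C.
Proof.
move=> /Krho Kz /Krho Ku; rewrite (le_trans (cmodB _ _))// (le_trans _ C_ge)//; lra.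
Qed.

Let kernE2 z u : K z -> K u ->
  (- lne (1 - sph z u)%:E + c%:E =
   kern C z u + kern C z u + ((ln (h z))%:E + (ln (h u))%:E))%E.
Proof.
move=> Kz Ku; rewrite kernE ?kern_diam// sphE.
have [<-|zu] := eqVneq z u.
  have -> : cmod (z - z) ^+ 2 = 0 by rewrite subrr cmod0 expr0n.
  by rewrite mulr0 mul0r le0_lneNy// log_kernel_diag.
have d0 : 0 < cmod (z - u) by rewrite cmod_gt0 subr_eq0.
rewrite log_kernel_neq// lne_EFin; last first.
  by apply: divr_gt0; apply: mulr_gt0 => //; [apply: mulr_gt0 => //|]; exact: exprn_gt0.
rewrite -?EFinN -!EFinD; congr EFin.
have M2 : 0 < 2 * M ^+ 2 by apply: mulr_gt0 => //; exact: exprn_gt0.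
have d2 : 0 < cmod (z - u) ^+ 2 by exact: exprn_gt0.
have E1 : ln (2 * M ^+ 2 * cmod (z - u) ^+ 2 / (h z * h u)) =
    ln (2 * M ^+ 2) + (ln (cmod (z - u)) *+ 2) - (ln (h z) + ln (h u)).
  rewrite ln_div ?posrE; [|exact: mulr_gt0|exact: mulr_gt0].
  by rewrite lnM ?posrE// lnXn// [ln (h z * _)]lnM ?posrE.
by rewrite E1 /c; ring.
Qed.

Let kcvg z u : K z -> K u -> (k N z u)%:E @[N --> \oo] -->
  (kern C z u + kern C z u + ((ln (h z))%:E + (ln (h u))%:E))%E.
Proof.
move=> Kz Ku; rewrite -kernE2//.
rewrite (_ : (fun N => _) = (fun N => (log_partial N (sph z u))%:E + c%:E)%E)//.
apply: cvgeD; last exact: cvg_cst.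
  exact: fin_num_adde_defl.
by apply: log_partial_cvg; exact: sph_bound.
Qed.

Let lnh_ge0 z : (0 <= (ln (h z))%:E)%E.
Proof. by rewrite lee_fin ln_ge0. Qed.

Let mlnh : measurable_fun setT (fun z : B => (ln (h z))%:E).
Proof. by apply/measurable_EFinP; apply: (measurableT_comp (f := @ln R)) => //. Qed.

Let G (mu : probability B R) := (\int[mu]_(z in K) (ln (h z))%:E)%E.

(** Finiteness allows the one-variable terms to be cancelled from the two sides of the energy
    inequality. *)
Let G_fin (mu : probability B R) : mu K = 1%E -> G mu \is a fin_num.
Proof.
move=> muK; rewrite ge0_fin_numE; last by apply: integral_ge0 => z _.
apply: (@le_lt_trans _ _ (\int[mu]_(z in K) (ln (M ^+ 2 + rho ^+ 2))%:E)%E).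
  apply: ge0_le_integral => //.
  - exact: measurable_funTS.
  - move=> z Kz; rewrite lee_fin ler_ln ?posrE//.
      by rewrite lerD2l lerXn2r ?nnegrE ?cmod_ge0 ?Krho//; move: rho1 => *; lra.
    by rewrite ltr_wpDr ?sqr_ge0// exprn_gt0.
by rewrite (integral_carrier_cst mK muK) ltry.
Qed.

Let mutual_energy_K (mu nu : probability B R) : mu K = 1%E -> nu K = 1%E ->
  (\int[mu]_(z in K) \int[nu]_(u in K)
    (kern C z u + kern C z u + ((ln (h z))%:E + (ln (h u))%:E)) =
   mutual_energy C mu nu + mutual_energy C mu nu + (G mu + G nu))%E.
Proof.
move=> muK nuK.
have inner z : (\int[nu]_(u in K)
    (kern C z u + kern C z u + ((ln (h z))%:E + (ln (h u))%:E)) =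
   potential C nu z + potential C nu z + ((ln (h z))%:E + G nu))%E.
  have mk : measurable_fun (K : set B) (kern C z).
    by apply: measurable_funTS; exact: measurable_kernr.
  have ml : measurable_fun (K : set B) (fun z : B => (ln (h z))%:E).
    exact: measurable_funTS.
  rewrite ge0_integralD//; last 4 first.
  - by move=> u _; rewrite adde_ge0// kern_ge0.
  - exact: emeasurable_funD.
  - by move=> u _; rewrite adde_ge0.
  - exact: emeasurable_funD.
  rewrite ge0_integralD//; try by move=> u _; exact: kern_ge0.
  rewrite ge0_integralD// (integral_carrier_cst mK nuK).
  rewrite /potential [in RHS](ge0_integral_carrier mK nuK)//; first exact: measurable_kernr.
  by move=> u; exact: kern_ge0.
under eq_integral do rewrite inner.
have mp : measurable_fun (K : set B) (potential C nu).
  by apply: measurable_funTS; exact: measurable_potential.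
have ml : measurable_fun (K : set B) (fun z : B => (ln (h z))%:E).
  exact: measurable_funTS.
have Gnu0 : (0 <= G nu)%E by apply: integral_ge0.
rewrite ge0_integralD//; last 4 first.
- by move=> u _; rewrite adde_ge0// potential_ge0.
- exact: emeasurable_funD.
- by move=> u _; rewrite adde_ge0.
- exact: emeasurable_funD.
rewrite ge0_integralD//; try by move=> u _; exact: potential_ge0.
rewrite ge0_integralD// (integral_carrier_cst mK muK).
rewrite /mutual_energy [in RHS](ge0_integral_carrier mK muK)//; first exact: measurable_potential.
by move=> u; exact: potential_ge0.
Qed.

Lemma mutual_energy_le (mu nu : probability B R) : mu K = 1%E -> nu K = 1%E ->
  (mutual_energy C mu nu + mutual_energy C mu nu <=
   mutual_energy C mu mu + mutual_energy C nu nu)%E.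
Proof.
move=> muK nuK.
have k0 N z u : K z -> K u -> 0 <= k N z u.
  move=> Kz Ku; rewrite addr_ge0// log_partial_ge0//.
  by have /andP[] := sph_bound Kz Ku.
have knd z u : K z -> K u -> nondecreasing_seq (fun N => k N z u).
  move=> Kz Ku m n mn; rewrite lerD2r; apply: log_partial_nd => //.
  by have /andP[] := sph_bound Kz Ku.
have := limit_kernel_energy mK mu nu k_features k0 knd kcvg.
rewrite !mutual_energy_K//.
rewrite -(fineK (G_fin muK)) -(fineK (G_fin nuK)).
have := mutual_energy_ge0 C mu nu; have := mutual_energy_ge0 C mu mu.
have := mutual_energy_ge0 C nu nu.
case: (mutual_energy C mu mu) => [a| |]//; case: (mutual_energy C nu nu) => [b| |]//;
  case: (mutual_energy C mu nu) => [e| |]// _ _ _.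
by rewrite -!EFinD !lee_fin; lra.
all: by move=> _; rewrite ?addey ?addye ?leey.
Qed.

End PositiveDefinite.

(** * Transport of measures *)

Section MakeProbability.
Context d (T : measurableType d) (R : realType).
Local Open Scope ereal_scope.

(** [mnormalize] supplies the probability structure; dividing by the mass 1 changes no value. *)
Lemma probability_of_measure (m : {measure set T -> \bar R}) : m setT = 1 ->
  exists P : probability T R, forall f : T -> \bar R,
    \int[P]_t f t = \int[m]_t f t.
Proof.
move=> m1; exists (mnormalize m (dirac point)) => f.
apply: eq_measure_integral => A mA _.
by rewrite /= /mnormalize m1 /= onee_eq0/= invr1 mule1.
Qed.

Lemma measure_carrier (mu : probability T R) (K : set T) : measurable K ->
  mu K = \int[mu]_t (\1_K t)%:E.
Proof. by move=> mK; rewrite integral_indic// setIT. Qed.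

Lemma probability_restrict (mu : probability T R) (S : set T) : measurable S ->
  0 < mu S -> exists nu : probability T R,
  forall f : T -> \bar R, measurable_fun setT f -> (forall t, 0 <= f t) ->
    \int[nu]_t f t = (fine (mu S))^-1%:E * \int[mu]_(t in S) f t.
Proof.
move=> mS S0.
have Sfin : mu S \is a fin_num by exact: fin_num_measure.
have c0 : (0 <= (fine (mu S))^-1)%R by rewrite invr_ge0 fine_ge0.
pose m := mscale (NngNum c0) (mrestr mu mS).
have [|P hP] := @probability_of_measure m.
  transitivity ((fine (mu S))^-1%:E * mu S).
    by congr (_ * _); rewrite /= /mrestr setTI.
  rewrite -[X in _ * X](fineK Sfin) -EFinM mulVf//.
  by rewrite gt_eqF// fine_gt0// S0 ltey_eq Sfin.
exists P => f mf f0; rewrite hP ge0_integral_mscale//=; congr (_ * _).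
rewrite (ge0_negligible_integral (N := ~` S))//; last 2 first.
- exact: measurableC.
- by rewrite /= /mrestr setICl measure0.
rewrite setTD setCK; apply: eq_measure_integral => A mA AS.
by rewrite /= /mrestr; congr (mu _); exact/setIidPl.
Qed.

End MakeProbability.

Section PushForward.
Context d (T : measurableType d) (R : realType) d' (T' : measurableType d').
Local Open Scope ereal_scope.

Definition push_measure (mu : {measure set T -> \bar R}) (g : T -> T')
    (mg : measurable_fun setT g) : {measure set T' -> \bar R} :=
  measure_function_pushforward__canonical__measure_function_Measure mu mg.

Lemma ge0_integral_push (mu : {measure set T -> \bar R}) g (mg : measurable_fun setT g)
    (f : T' -> \bar R) : measurable_fun setT f -> (forall t, 0 <= f t) ->
  \int[push_measure mu mg]_t f t = \int[mu]_t f (g t).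
Proof. by move=> mf f0; rewrite [LHS]ge0_integral_pushforward. Qed.

(* The image of [mu] under a uniformly random one of the maps [g i]. *)
Lemma probability_push_mean (mu : probability T R) (n : nat) (g : nat -> T -> T') :
  (0 < n)%N -> (forall i, measurable_fun setT (g i)) ->
  exists nu : probability T' R,
  forall f : T' -> \bar R, measurable_fun setT f -> (forall t, 0 <= f t) ->
    \int[nu]_t f t = n%:R^-1%:E * \sum_(i < n) \int[mu]_t f (g i t).
Proof.
move=> n0 mg.
have c0 : (0 <= n%:R^-1 :> R)%R by rewrite invr_ge0.
pose m := mscale (NngNum c0) (msum (fun i => push_measure mu (mg i)) n).
have [|P hP] := @probability_of_measure _ _ _ m.
  transitivity (n%:R^-1%:E * \sum_(i < n) (1 : \bar R)).
    congr (_ * _); apply: eq_bigr => i _.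
    by rewrite /push_measure /= /pushforward preimage_setT; exact: probability_setT.
  by rewrite sumEFin sumr_const card_ord -EFinM mulVf// pnatr_eq0 -lt0n.
exists P => f mf f0; rewrite hP ge0_integral_mscale//=; congr (_ * _).
rewrite ge0_integral_measure_sum//; apply: eq_bigr => i _.
exact: ge0_integral_push.
Qed.

End PushForward.

(** * Energies along a polynomial *)

Lemma mean_const (R : realType) (m : nat) (x : \bar R) : (0 < m)%N ->
  (m%:R^-1%:E * \sum_(i < m) x = x)%E.
Proof.
move=> m0; have m1 : (m%:R : R) != 0 by rewrite pnatr_eq0 -lt0n.
have -> : (\sum_(i < m) x = m%:R%:E * x)%E.
  by rewrite mule_natl sumr_const card_ord.
by rewrite muleA -EFinM mulVf// mul1e.
Qed.

Lemma ln_prod (R : realType) n (x : 'I_n -> R) : (forall i, 0 < x i) ->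
  ln (\prod_(i < n) x i) = \sum_(i < n) ln (x i).
Proof.
move=> x0; suff [] : 0 < \prod_(i < n) x i /\ ln (\prod_(i < n) x i) = \sum_(i < n) ln (x i) by [].
elim/big_ind2 : _ => [|a b c d [a0 ha] [c0 hc]|//].
  by rewrite ln1.
by rewrite mulr_gt0// lnM ?posrE// ha hc.
Qed.

Lemma measurable_EFin_indic d (T : measurableType d) (R : realType) (A : set T) :
  measurable A -> measurable_fun setT (fun t => (\1_A t : R)%:E).
Proof. by move=> mA; apply/measurable_EFinP; exact: measurable_indic. Qed.

Section PullBack.
Variable R : realType.
Local Notation cC := (cplx R).
Local Notation B := (borel_cplx R).
Variables (m : nat) (p : {poly cC}) (L : set cC) (rho C : R).
Let K : set cC := [set z | L p.[z]].
Let a := lead_coef p.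
(** If z is within [expR C] of each of the m roots of p - w, then |p(z) - w| <= |a| expR (m C) =
    [expR CL]. *)
Let CL := ln (cmod a) + m%:R * C.
Hypotheses (m0 : (0 < m)%N) (hp : size p = m.+1) (mL : measurable (L : set B))
  (rho1 : 1 <= rho) (Krho : forall z, K z -> cmod z <= rho)
  (C_ge : 2 * rho <= expR C).

Let a0 : a != 0.
Proof. by rewrite lead_coef_eq0 -size_poly_eq0 hp. Qed.

Lemma measurable_preimage_poly : measurable (K : set B).
Proof. by rewrite -[X in measurable X]setTI; exact: (measurable_poly p). Qed.

Let mK := measurable_preimage_poly.

Lemma measurable_fibre : exists2 r : nat -> B -> B,
  (forall i, measurable_fun setT (r i)) &
  forall w : cC, p - w%:P = a *: \prod_(i < m) ('X - (r i w : cC)%:P).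
Proof.
have sw (w : cC) : size (p - w%:P) = m.+1.
  by rewrite size_polyDl// size_polyN hp (leq_ltn_trans (size_polyC_leq1 _)).
have lw (w : cC) : lead_coef (p - w%:P) = a.
  by rewrite lead_coefDl// size_polyN hp (leq_ltn_trans (size_polyC_leq1 _)).
have [||i|r mr hr] := @measurable_roots R _ B m (fun w => a^-1 *: (p - (w : cC)%:P)).
- by move=> w; rewrite monicE lead_coefZ lw mulVf.
- by move=> w; rewrite size_scale ?invr_eq0.
- rewrite (_ : (fun t => _) = (fun t : B => a^-1 * (p`_i - (if i == 0%N then t : cC else 0)))); last first.
    by apply/funext => w; rewrite coefZ coefB coefC.
  apply: measurable_cM => //; apply: measurable_cB => //.
  by case: (i == 0%N).
by exists r => // w; rewrite -hr scalerA mulfV// scale1r.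
Qed.

Variables (r : nat -> B -> B).
Hypotheses (mr : forall i, measurable_fun setT (r i))
  (hr : forall w : cC, p - w%:P = a *: \prod_(i < m) ('X - (r i w : cC)%:P)).

Let rE i (w : cC) : (i < m)%N -> p.[r i w] = w.
Proof.
move=> im; have : (p - w%:P).[r i w] = 0.
  rewrite hr hornerZ horner_prod (bigD1 (Ordinal im))//= hornerXsubC subrr.
  by rewrite mul0r mulr0.
by rewrite hornerD hornerN hornerC => /eqP; rewrite subr_eq0 => /eqP.
Qed.

Let rK i (w : cC) : (i < m)%N -> K (r i w) = L w.
Proof. by move=> im; rewrite /K /= rE. Qed.

Let factorE (z w : cC) : p.[z] - w = a * \prod_(i < m) (z - r i w).
Proof.
transitivity (p - w%:P).[z]; first by rewrite hornerD hornerN hornerC.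
rewrite hr hornerZ horner_prod; congr (_ * _).
by apply: eq_bigr => i _; rewrite hornerXsubC.
Qed.

Let K_diam z u : K z -> K u -> cmod (z - u) <= expR C.
Proof.
move=> /Krho Kz /Krho Ku; rewrite (le_trans (cmodB _ _))// (le_trans _ C_ge)//; lra.
Qed.

Lemma fibre_diam (z w : cC) : K z -> L w -> cmod (p.[z] - w) <= expR CL.
Proof.
move=> Kz Lw; rewrite factorE cmodM cmod_prod /CL expRD lnK ?posrE ?cmod_gt0//.
rewrite ler_wpM2l ?cmod_ge0// expRM_natl -[X in _ ^+ X]card_ord -prodr_const.
by apply: ler_prod => i _; rewrite cmod_ge0 K_diam// rK.
Qed.

(** The logarithm of the factorisation of p(z) - w. The shift [CL] absorbs log |a| and hands one [C]
    to each root; when p(z) = w both sides are +oo. *)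
Lemma kern_fibre (z w : cC) : K z -> L w ->
  kern CL p.[z] w = (\sum_(i < m) kern C z (r i w))%E.
Proof.
move=> Kz Lw; rewrite kernE ?fibre_diam//.
have Kr (i : 'I_m) : K (r i w) by rewrite rK.
have [pzw|pzw] := eqVneq p.[z] w.
  rewrite pzw log_kernel_diag addye//.
  have : \prod_(i < m) (z - r i w) == 0.
    have := factorE z w; rewrite pzw subrr => /esym/eqP.
    by rewrite mulf_eq0 (negbTE a0).
  move=> /prodf_eq0[i _]; rewrite subr_eq0 => /eqP zi.
  rewrite (bigD1 i)//= -zi kernE ?K_diam// log_kernel_diag addye//.
  rewrite gt_eqF//; apply: (lt_le_trans (ltNyr 0)); apply: sume_ge0 => j _; exact: kern_ge0.
have nz (i : 'I_m) : z != r i w.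
  apply: contra_neq pzw => ->; exact: rE.
rewrite log_kernel_neq// factorE cmodM cmod_prod.
rewrite lnM ?posrE ?cmod_gt0//; last first.
  by apply: prodr_gt0 => i _; rewrite cmod_gt0 subr_eq0.
rewrite ln_prod; last by move=> i; rewrite cmod_gt0 subr_eq0.
transitivity (\sum_(i < m) (- ln (cmod (z - r i w)) + C)%:E)%E; last first.
  by apply: eq_bigr => i _; rewrite kernE ?K_diam// log_kernel_neq.
rewrite sumEFin big_split /= sumr_const card_ord -EFinD sumrN /CL -mulr_natl.
by congr EFin; ring.
Qed.

Section Pull.
Variables (tau nu : probability B R).
Hypotheses (tauL : tau L = 1%E) (nuE : forall f : B -> \bar R,
  measurable_fun setT f -> (forall t, 0 <= f t)%E ->
  (\int[nu]_t f t = m%:R^-1%:E * \sum_(i < m) \int[tau]_t f (r i t))%E).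

Lemma pull_carrier : nu K = 1%E.
Proof.
rewrite (measure_carrier _ mK) nuE//; last exact: measurable_EFin_indic.
rewrite -[RHS](@mean_const R m)//; congr (_ * _)%E; apply: eq_bigr => i _.
rewrite -tauL (measure_carrier _ mL); apply: eq_integral => w _.
by rewrite /= !indicE; congr (_%:R)%:E; congr nat_of_bool; apply/idP/idP;
  rewrite !inE rK.
Qed.

Lemma pull_potential z : K z ->
  potential C nu z = (m%:R^-1%:E * potential CL tau p.[z])%E.
Proof.
move=> Kz; rewrite /potential nuE; last 2 first.
- exact: measurable_kernr.
- by move=> t; exact: kern_ge0.
congr (_ * _)%E; rewrite -ge0_integral_sum//; last 2 first.
- by move=> i; apply: measurable_kern.
- by move=> i t _; exact: kern_ge0.
apply: (integral_carrier_eq mL tauL).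
- by apply: emeasurable_sum => i; apply: measurable_kern.
- exact: measurable_kernr.
by move=> w Lw; rewrite kern_fibre.
Qed.

Lemma pull_mutual_energy (mu sigma : probability B R) : mu K = 1%E ->
  (forall f : B -> \bar R, measurable_fun setT f -> (forall t, 0 <= f t)%E ->
    (\int[sigma]_t f t = \int[mu]_t f p.[t])%E) ->
  mutual_energy C mu nu = (m%:R^-1%:E * mutual_energy CL sigma tau)%E.
Proof.
move=> muK sE; rewrite /mutual_energy sE; last 2 first.
- exact: measurable_potential.
- exact: potential_ge0.
have mpp : measurable_fun setT (fun z : B => potential CL tau p.[z]).
  by apply: (measurableT_comp (measurable_potential CL tau)); exact: measurable_poly.
rewrite -ge0_integralZl//; last by move=> z _; exact: potential_ge0.
apply: (integral_carrier_eq mK muK).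
- exact: measurable_potential.
- by apply: emeasurable_funM.
by move=> z Kz; rewrite pull_potential.
Qed.

(** Every branch [r i] is a section of [p], so the image of [nu] under [p] is [tau] itself. *)
Lemma pull_energy : mutual_energy C nu nu = (m%:R^-1%:E * mutual_energy CL tau tau)%E.
Proof.
apply: pull_mutual_energy pull_carrier _ => f mf f0.
have mfp : measurable_fun setT (fun z : B => f p.[z]).
  by apply: (measurableT_comp mf); exact: measurable_poly.
rewrite nuE//.
rewrite -[LHS](@mean_const R m)//; congr (_ * _)%E; apply: eq_bigr => i _.
by apply: eq_integral => w _; rewrite rE.
Qed.

End Pull.

Lemma exists_pull (tau : probability B R) : exists nu : probability B R,
  forall f : B -> \bar R, measurable_fun setT f -> (forall t, 0 <= f t)%E ->
  (\int[nu]_t f t = m%:R^-1%:E * \sum_(i < m) \int[tau]_t f (r i t))%E.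
Proof. exact: probability_push_mean. Qed.

Lemma exists_push (mu : probability B R) : exists sigma : probability B R,
  forall f : B -> \bar R, measurable_fun setT f -> (forall t, 0 <= f t)%E ->
  (\int[sigma]_t f t = \int[mu]_t f p.[t])%E.
Proof.
(* The mean over a single map is the plain image measure. *)
have [s hs] := probability_push_mean mu (g := fun _ (z : B) => (p.[z] : B)) (ltn0Sn 0)
  (fun _ => measurable_poly p).
by exists s => f mf f0; rewrite hs// big_ord1 invr1 mul1e.
Qed.

(* With nu the pull-back of the push-forward sigma of mu, both I(nu, nu) and
   I(mu, nu) equal I(sigma, sigma) / m, so that 2 I(mu, nu) <= I(mu, mu) +
   I(nu, nu) bounds I(sigma, sigma) once it is known to be finite. *)
Lemma bounded_potential_push (mu : probability B R) (N : R) : 0 <= N -> mu K = 1%E ->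
  (forall z, K z -> potential C mu z <= N%:E)%E ->
  exists2 sigma : probability B R, sigma L = 1%E &
    (m%:R^-1%:E * mutual_energy CL sigma sigma <= mutual_energy C mu mu)%E.
Proof.
move=> N0 muK muN; have [sigma sE] := exists_push mu.
have [nu nuE] := exists_pull sigma.
have sL : sigma L = 1%E.
  rewrite (measure_carrier _ mL) sE//; last exact: measurable_EFin_indic.
  by rewrite -muK (measure_carrier _ mK).
exists sigma => //.
have E1 := pull_energy sL nuE.
have E2 := pull_mutual_energy sL nuE muK sE.
(* By [kern_fibre] the potential of [sigma] at w is the sum of the potentials of [mu] over the fibre
   of w, hence at most m N. *)
have fin : (mutual_energy CL sigma sigma <= (m%:R * N)%:E)%E.
  rewrite -(integral_prob_cst sigma (m%:R * N)).
  have mN0 : (0 <= m%:R * N)%R by rewrite mulr_ge0.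
  apply: (ge0_integral_carrier_le mL sL) => //.
  - exact: measurable_potential.
  - by move=> t; exact: potential_ge0.
  move=> w Lw; rewrite /potential sE; last 2 first.
  - exact: measurable_kernr.
  - by move=> t; exact: kern_ge0.
  have -> : (\int[mu]_t kern CL w p.[t] = \int[mu]_t (\sum_(i < m) kern C (r i w) t))%E.
    apply: (integral_carrier_eq mK muK).
    - apply: measurable_kern => //; exact: measurable_poly.
    - by apply: emeasurable_sum => i; exact: measurable_kernr.
    move=> z Kz; rewrite kernC kern_fibre//; apply: eq_bigr => i _; exact: kernC.
  rewrite ge0_integral_sum//; last 2 first.
  - by move=> i; exact: measurable_kernr.
  - by move=> i t _; exact: kern_ge0.
  apply: (@le_trans _ _ (\sum_(i < m) N%:E)%E).
    by apply: lee_sum => i _; apply: muN; rewrite rK.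
  by rewrite sumEFin lee_fin sumr_const card_ord mulr_natl.
have := mutual_energy_le mK rho1 Krho C_ge muK (pull_carrier sL nuE).
rewrite E1 E2.
have := mutual_energy_ge0 CL sigma sigma.
move: fin; case: (mutual_energy CL sigma sigma) => [x| |]// _ _.
by rewrite -EFinM leeD2rE.
Qed.

End PullBack.

(** * A maximum principle for potentials *)

Lemma kern_diag (R : realType) C (z : cplx R) : kern C z z = +oo%E.
Proof. by rewrite /kern log_kernel_diag addye// maxey. Qed.

Section MaximumPrinciple.
Variable R : realType.
Local Notation cC := (cplx R).
Local Notation B := (borel_cplx R).
Variables (C : R) (mu : probability B R) (S : set cC).
Hypothesis mS : measurable (S : set B).

(** A closest point of [S] exists only up to an error. Cutting the distance off at 1 / (n + 1) makes
    an error of that size affordable, and the cut kernels increase to [kern]. *)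
Let kcut (z : cC) (n : nat) (u : cC) : R :=
  Num.max 0 (C - ln (Num.max (cmod (z - u)) n.+1%:R^-1)).

Let cut_gt0 (z u : cC) n : 0 < Num.max (cmod (z - u)) n.+1%:R^-1.
Proof. by rewrite lt_max invr_gt0 ltr0n orbT. Qed.

Let mkcut z n : measurable_fun setT (fun u : B => (kcut z n u)%:E).
Proof.
apply/measurable_EFinP; apply: measurable_maxr => //.
apply: measurable_funB => //; apply: (measurableT_comp (f := @ln R)) => //.
apply: measurable_maxr => //; apply: measurable_cmod; exact: measurable_cB.
Qed.

Let kcut_nd (z u : cC) : nondecreasing_seq (fun n => (kcut z n u)%:E).
Proof.
move=> n k nk; rewrite lee_fin /kcut.
rewrite ge_max le_max lexx /= le_max; apply/orP; right.
rewrite lerB// ler_ln ?posrE ?cut_gt0//.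
rewrite ge_max le_max lexx /= le_max; apply/orP; right.
by rewrite lef_pV2 ?posrE// ler_nat ltnS.
Qed.

Let kcut_cvg (z u : cC) : (kcut z n u)%:E @[n --> \oo] --> kern C z u.
Proof.
have [<-|zu] := eqVneq z u.
  rewrite kern_diag.
  apply/cvgeyPge => A; near=> n; rewrite lee_fin /kcut subrr cmod0.
  rewrite le_max; apply/orP; right.
  rewrite (max_idPr (_ : 0 <= _)) ?invr_ge0// lnV ?posrE// opprK.
  rewrite -lerBlDl -[leLHS]expRK ler_ln ?posrE ?expR_gt0//.
  rewrite (le_trans (_ : _ <= n%:R))//; last by rewrite ler_nat.
  by near: n; exact: nbhs_infty_ger.
have d0 : 0 < cmod (z - u) by rewrite cmod_gt0 subr_eq0.
apply: cvg_near_cst; near=> n.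
have -> : kcut z n u = Num.max 0 (C - ln (cmod (z - u))).
  rewrite /kcut; congr (Num.max 0 (C - ln _)); apply/max_idPl.
  rewrite invf_ple ?posrE// (le_trans (_ : _ <= n%:R))//; last by rewrite ler_nat.
  by near: n; exact: nbhs_infty_ger.
by rewrite /kern log_kernel_neq// -EFinD addrC EFin_max.
Unshelve. all: by end_near. Qed.

Let near_closest (z : cC) (e : R) : S !=set0 -> 0 < e ->
  exists2 z', S z' & forall u, S u -> cmod (z - z') <= cmod (z - u) + e.
Proof.
move=> [u0 Su0] e0; have hi : has_inf [set cmod (z - u) | u in S].
  split; first by exists (cmod (z - u0)); exists u0.
  by exists 0 => _ [u _ <-]; exact: cmod_ge0.
have [_ [z' Sz' <-] zz'] := inf_adherent e0 hi; exists z' => // u Su.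
rewrite (le_trans (ltW zz'))// lerD2r ge_inf//; first exact: hi.2.
by exists u.
Qed.

(* A crude form of the maximum principle for potentials: a point z is replaced
   by an (almost) closest point z' of S, for which |z' - u| <= 3 |z - u| on S. *)
Lemma potential_max_principle (N : R) z : 0 <= N ->
  (forall u, S u -> potential C mu u <= N%:E)%E ->
  (\int[mu]_(u in S) kern C z u <= (N + ln 3)%:E)%E.
Proof.
move=> N0 SN; have ln3 : 0 <= ln 3 :> R by rewrite ln_ge0// ler1n.
have [S0|/set0P/negP/negPn/eqP ->] := pselect (S !=set0); last first.
  by rewrite integral_set0 lee_fin addr_ge0.
have bound n : (\int[mu]_(u in S) (kcut z n u)%:E <= (N + ln 3)%:E)%E.
  (* With error 1 / (n + 1), the triangle inequality gives |z' - u| <= 2 |z - u| + 1 / (n + 1), at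
     most 3 times the cut distance; this is the origin of [ln 3]. *)
  have [z' Sz' hz'] := near_closest z S0 (invS_pos R n).
  apply: (@le_trans _ _ (\int[mu]_(u in S) (kern C z' u + (ln 3)%:E))%E).
    apply: ge0_le_integral => //.
    - by move=> u _; rewrite lee_fin le_max lexx.
    - exact: measurable_funTS.
    - by apply: emeasurable_funD => //; apply: measurable_funTS; exact: measurable_kernr.
    move=> u Su; rewrite /kcut EFin_max ge_max adde_ge0 ?kern_ge0 ?lee_fin//=.
    have [<-|zu] := eqVneq z' u.
      rewrite kern_diag.
      by rewrite addye// leey.
    rewrite (@le_trans _ _ ((- ln (cmod (z' - u)))%:E + C%:E + (ln 3)%:E)%E)//; last first.
      by rewrite leeD2r// /kern log_kernel_neq// le_max lexx orbT.
    rewrite -!EFinD lee_fin; set dd := Num.max _ _.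
    have d0 : 0 < dd by exact: cut_gt0.
    have z'u0 : 0 < cmod (z' - u) by rewrite cmod_gt0 subr_eq0.
    have : ln (cmod (z' - u)) <= ln (3 * dd).
      rewrite ler_ln ?posrE ?mulr_gt0//.
      have h1 : cmod (z - u) <= dd by rewrite le_max lexx.
      have h2 : n.+1%:R^-1 <= dd by rewrite le_max lexx orbT.
      have h3 := hz' _ Su.
      have : cmod (z' - u) <= cmod (z' - z) + cmod (z - u).
        by have := cmodD (z' - z) (z - u); rewrite addrA subrK.
      rewrite (cmodBC z' z); move: h2 h3; move: (n.+1%:R^-1) => e; lra.
    rewrite lnM ?posrE//; lra.
  rewrite ge0_integralD//; last 2 first.
  - by move=> u _; exact: kern_ge0.
  - by apply: measurable_funTS; exact: measurable_kernr.
  rewrite EFinD leeD//.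
    apply: le_trans (SN _ Sz'); apply: ge0_subset_integral => //.
    - exact: measurable_kernr.
    - by move=> u _; exact: kern_ge0.
  rewrite integral_cst// -[leRHS]mule1 lee_wpmul2l ?lee_fin//.
  exact: probability_le1.
have H : (\int[mu]_(u in S) (kcut z n u)%:E)%E @[n --> \oo] -->
    (\int[mu]_(u in S) kern C z u)%E.
  rewrite (_ : (\int[mu]_(u in S) kern C z u =
     \int[mu]_(u in S) limn (fun n => (kcut z n u)%:E))%E); last first.
    by apply: eq_integral => u _; apply/esym/cvg_lim => //; exact: kcut_cvg.
  apply: cvg_monotone_convergence => //.
  - by move=> n; exact: measurable_funTS.
  - by move=> n u _; rewrite lee_fin le_max lexx.
rewrite -(cvg_lim _ H)//; apply: lime_le; first by apply/cvg_ex; eexists; exact: H.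
exact: nearW.
Qed.

End MaximumPrinciple.

(** * Lower bounds for energies on the preimage *)

Lemma truncation_limit (R : realType) (J v : R) : 0 <= J -> 0 <= v ->
  (forall N, J < N -> (1 - J / N) ^+ 2 * v <= J) -> v <= J.
Proof.
move=> J0 v0 H; rewrite leNgt; apply/negP => Jv.
have vJ : 0 < v - J by rewrite subr_gt0.
(* Large enough for J < N and 2 (J / N) v < v - J; then (1 - J / N)^2 v >= v - 2 (J / N) v > J. *)
pose N := J + 2 * J * v / (v - J) + 1.
have q0 : 0 <= 2 * J * v / (v - J).
  by apply: divr_ge0; [apply: mulr_ge0; [exact: mulr_ge0|]|exact: ltW].
have JN : J < N by rewrite /N; lra.
have N0 : 0 < N by exact: le_lt_trans JN.
have := H N JN; set x := J / N.
have e : x * N = J by rewrite divfK// gt_eqF.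
have q : 2 * J * v / (v - J) * (v - J) = 2 * J * v by rewrite divfK// gt_eqF.
have NN : 2 * J * v < N * (v - J) by rewrite /N; nra.
have : 2 * x * v < v - J.
  rewrite -(ltr_pM2r N0) [ltRHS]mulrC (le_lt_trans _ NN)//.
  by rewrite -e le_eqVlt; apply/orP; left; apply/eqP; ring.
have := sqr_ge0 x; nra.
Qed.

Section EnergyPreimage.
Variable R : realType.
Local Notation cC := (cplx R).
Local Notation B := (borel_cplx R).
Variables (m : nat) (p : {poly cC}) (L : set cC) (rho C : R).
Let K : set cC := [set z | L p.[z]].
Let a := lead_coef p.
Let CL := ln (cmod a) + m%:R * C.
Hypotheses (m0 : (0 < m)%N) (hp : size p = m.+1) (mL : measurable (L : set B))
  (rho1 : 1 <= rho) (Krho : forall z, K z -> cmod z <= rho)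
  (C_ge : 2 * rho <= expR C).

Let mK : measurable (K : set B) := measurable_preimage_poly p mL.

(** Restrict [mu] to the points where its potential is at most N and normalise. By Markov's
    inequality the mass s kept is at least 1 - J / N. *)
Lemma truncated_push (mu : probability B R) (J N : R) : mu K = 1%E ->
  mutual_energy C mu mu = J%:E -> J < N ->
  exists2 sigma : probability B R, sigma L = 1%E &
    (m%:R^-1%:E * mutual_energy CL sigma sigma <= ((1 - J / N) ^- 2 * J)%:E)%E.
Proof.
move=> muK muJ JN.
have J0 : 0 <= J by rewrite -lee_fin -muJ mutual_energy_ge0.
have N0 : 0 < N by exact: le_lt_trans JN.
have t0 : 0 < 1 - J / N by rewrite subr_gt0 ltr_pdivrMr// mul1r.
pose S := K `&` [set z | (potential C mu z <= N%:E)%E].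
have mS : measurable (S : set B).
  apply: measurableI => //; rewrite -[X in measurable X]setTI.
  by apply: emeasurable_fun_infty_c => //; exact: measurable_potential.
have muS : ((1 - J / N)%:E <= mu S)%E.
  have mP : measurable ([set z | (N%:E <= potential C mu z)%E] : set B).
    rewrite -[X in measurable X]setTI.
    by apply: emeasurable_fun_c_infty => //; exact: measurable_potential.
  have markov : (mu [set z | (N%:E <= potential C mu z)%E] <= (J / N)%:E)%E.
    have := @le_integral_comp_abse _ _ _ mu _ measurableT (potential C mu) N id
      (@measurable_id _ _ _) (fun _ => id) (fun _ _ _ _ => id)
      (measurable_potential C mu) N0.
    rewrite setTI (_ : (\int[mu]_x id `|potential C mu x| = J%:E)%E); last first.
      rewrite -muJ; apply: eq_integral => z _.
      by rewrite gee0_abs// potential_ge0.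
    rewrite (_ : [set x | _] = [set z | (N%:E <= potential C mu z)%E]); last first.
      by apply/seteqP; split => z /=; rewrite gee0_abs// potential_ge0.
    by rewrite EFinM lee_pdivlMr// muleC.
  have : (mu (~` S) <= (J / N)%:E)%E.
    have sub : ~` S `<=` ~` K `|` [set z | (N%:E <= potential C mu z)%E].
      move=> z /not_andP[nK|/negP]; first by left.
      by rewrite -ltNge => /ltW; right.
    rewrite (le_trans (le_measure mu _ _ sub)) ?inE//.
    - exact: measurableC.
    - by apply: measurableU => //; exact: measurableC.
    rewrite (le_trans (measureU2 _ _ _))//; first exact: measurableC.
    rewrite -[leRHS]add0e leeD// le_eqVlt; apply/orP; left; apply/eqP.
    exact: probability_compl0.
  rewrite probability_setC// => H.
  have Sfin : mu S \is a fin_num by exact: fin_num_measure.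
  move: H; rewrite -(fineK Sfin) -EFinB !lee_fin; lra.
have S0 : (0 < mu S)%E by rewrite (lt_le_trans _ muS)// lte_fin.
have Sfin : mu S \is a fin_num by exact: fin_num_measure.
set s := fine (mu S).
have sE : mu S = s%:E by rewrite fineK.
have s0 : 0 < s by rewrite -lte_fin -sE.
have ts : 1 - J / N <= s by rewrite -lee_fin -sE.
have [nu nuE] := probability_restrict mS S0; rewrite -/s in nuE.
have mpot := measurable_potential C mu.
have nuK : nu K = 1%E.
  rewrite (measure_carrier _ mK) nuE//; last exact: measurable_EFin_indic.
  transitivity (s^-1%:E * s%:E)%E; last by rewrite -EFinM mulVf// gt_eqF.
  congr (_ * _)%E; rewrite -sE integral_indic//.
  by congr (mu _); apply/setIidPr => z [].
have nuP z : (potential C nu z <= s^-1%:E * potential C mu z)%E.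
  rewrite /potential nuE; last 2 first.
  - exact: measurable_kernr.
  - by move=> t; exact: kern_ge0.
  rewrite lee_wpmul2l ?lee_fin ?invr_ge0 ?(ltW s0)//.
  apply: ge0_subset_integral => //; first exact: measurable_kernr.
  by move=> u _; exact: kern_ge0.
(* The bound is required on all of [K], as the fibre of a point p(z) with z in [S] may leave [S];
   this is where the maximum principle enters. *)
have nuB z : K z -> (potential C nu z <= (s^-1 * (N + ln 3))%:E)%E.
  move=> Kz; rewrite /potential nuE; last 2 first.
  - exact: measurable_kernr.
  - by move=> t; exact: kern_ge0.
  rewrite EFinM lee_wpmul2l ?lee_fin ?invr_ge0 ?(ltW s0)//.
  by apply: potential_max_principle => //; [exact: ltW|move=> u []].
(* One factor 1 / s comes from the outer integral, the other from [nuP]. *)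
have nuJ : (mutual_energy C nu nu <= ((1 - J / N) ^- 2 * J)%:E)%E.
  apply: (@le_trans _ _ ((s ^- 2 * J)%:E)); last first.
    rewrite lee_fin ler_wpM2r// lef_pV2 ?posrE ?exprn_gt0//.
    by rewrite lerXn2r ?nnegrE ?(ltW t0) ?(ltW s0).
  rewrite /mutual_energy nuE; last 2 first.
  - exact: measurable_potential.
  - exact: potential_ge0.
  rewrite -exprVn expr2 -mulrA !EFinM lee_wpmul2l ?lee_fin ?invr_ge0 ?(ltW s0)//.
  apply: (@le_trans _ _ (\int[mu]_(z in S) (s^-1%:E * potential C mu z))%E).
    apply: ge0_le_integral => //.
    - by move=> z _; exact: potential_ge0.
    - by apply: measurable_funTS; exact: measurable_potential.
    - by apply: measurable_funTS; apply: emeasurable_funM.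
  rewrite ge0_integralZl//; last 3 first.
  - exact: measurable_funTS.
  - by move=> z _; exact: potential_ge0.
  - by rewrite lee_fin invr_ge0 ltW.
  rewrite lee_wpmul2l ?lee_fin ?invr_ge0 ?(ltW s0)// -muJ.
  by apply: ge0_subset_integral => // z _; exact: potential_ge0.
have B0 : 0 <= s^-1 * (N + ln 3).
  by rewrite mulr_ge0 ?invr_ge0 ?(ltW s0)// addr_ge0 ?(ltW N0)// ln_ge0// ler1n.
have [r mr hr] := measurable_fibre m0 hp.
have [sigma sL sJ] := bounded_potential_push m0 hp mL rho1 Krho C_ge mr hr B0 nuK nuB.
by exists sigma => //; exact: le_trans sJ nuJ.
Qed.

Lemma energy_preimage_ge (V : R) :
  (forall sigma : probability B R, sigma L = 1%E -> (V%:E <= mutual_energy CL sigma sigma)%E) ->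
  forall mu : probability B R, mu K = 1%E -> ((m%:R^-1 * V)%:E <= mutual_energy C mu mu)%E.
Proof.
move=> HV mu muK; have := mutual_energy_ge0 C mu mu.
case E : (mutual_energy C mu mu) => [J| |]//; last by move=> _; rewrite leey.
rewrite lee_fin => J0; rewrite lee_fin leNgt; apply/negP; set v := _ * V => Jv.
have v0 : 0 < v by exact: le_lt_trans Jv.
have H N : J < N -> (1 - J / N) ^+ 2 * v <= J.
  move=> JN; have N0 : 0 < N by exact: le_lt_trans JN.
  have t0 : 0 < 1 - J / N by rewrite subr_gt0 ltr_pdivrMr// mul1r.
  have [sigma sL] := truncated_push muK E JN.
  have : ((m%:R^-1 * V)%:E <= m%:R^-1%:E * mutual_energy CL sigma sigma)%E.
    by rewrite EFinM lee_wpmul2l ?lee_fin ?invr_ge0//; exact: HV.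
  move=> /le_trans/[apply]; rewrite lee_fin -/v => h.
  by rewrite -ler_pdivlMl ?exprn_gt0.
by move: Jv; rewrite ltNge (truncation_limit J0 (ltW v0) H).
Qed.

End EnergyPreimage.

(** * Robin constant and capacity *)

Lemma robin_preimage (R : realType) (m : nat) (p : {poly cplx R}) (L : set (cplx R)) (v : R) :
  (0 < m)%N -> size p = m.+1 -> measurable (L : set (borel_cplx R)) -> cbounded L ->
  robin L = v%:E ->
  robin [set z | L p.[z]] = (m%:R^-1 * (v + ln (cmod (lead_coef p))))%:E.
Proof.
move=> m0 hp mL Lb rL; set K := [set z | L p.[z]]; set a := lead_coef p.
set k := _ * _.
have m1 : 0 < m%:R :> R by rewrite ltr0n.
have [b b0 Kb] : cbounded K by apply: preimage_cbounded => //; rewrite hp.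
pose rho := b + 1; have rho1 : 1 <= rho by rewrite lerDr.
have Krho z : K z -> cmod z <= rho by move=> /Kb/le_trans; apply; rewrite lerDl.
pose C := ln (2 * rho).
have CE : expR C = 2 * rho by rewrite lnK// posrE mulr_gt0// (lt_le_trans ltr01).
have C_ge : 2 * rho <= expR C by rewrite CE.
pose CL := ln (cmod a) + m%:R * C.
have mK : measurable (K : set (borel_cplx R)) := measurable_preimage_poly p mL.
have [r mr hr] := measurable_fibre m0 hp.
(* As [p] is onto, a point of [L] lifts to [K], and [fibre_diam] bounds the diameter of [L]. *)
have LC w w' : L w -> L w' -> cmod (w - w') <= expR CL.
  move=> Lw Lw'; have [z zw] := poly_surj m0 hp w.
  by rewrite -zw; apply: (fibre_diam hp Krho C_ge hr) => //; rewrite /= zw.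
have KC z u : K z -> K u -> cmod (z - u) <= expR C.
  by move=> /Krho Kz /Krho Ku; rewrite (le_trans (cmodB _ _))// CE; lra.
have EK mu muK := log_energyE (mu := mu) mK muK KC.
have EL tau tauL := log_energyE (mu := tau) mL tauL LC.
have ge : (k%:E <= robin K)%E.
  apply: le_ereal_inf_tmp => _ [mu muK <-].
  rewrite EK// leeBrDr// -EFinD.
  have -> : k + C = m%:R^-1 * (v + CL).
    by rewrite /k /CL; field; rewrite gt_eqF.
  apply: (energy_preimage_ge m0 hp mL rho1 Krho C_ge) => // sigma sL.
  rewrite EFinD -leeBrDr// -EL// -rL.
  by apply: ereal_inf_lbound; exists sigma.
(* Stated for every real lower bound x so that it also excludes [robin K = +oo], by taking x = k +
   1; the value -oo is excluded by [ge]. *)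
have le x : (x%:E <= robin K)%E -> x <= k.
  move=> xK.
  have : ((m%:R * (x + C) - CL)%:E <= robin L)%E.
    apply: le_ereal_inf_tmp => _ [tau tauL <-].
    have [nu nuE] := exists_pull m0 mr tau.
    have nuK := pull_carrier m0 mL hr tauL nuE.
    have : (x%:E <= log_energy nu)%E.
      by apply: le_trans xK _; apply: ereal_inf_lbound; exists nu.
    rewrite EK// EL// (pull_energy m0 hp mL Krho C_ge mr hr tauL nuE).
    rewrite leeBrDr// -EFinD => h.
    rewrite EFinB leeB// EFinM.
    by rewrite -lee_pdivlMl.
  rewrite rL lee_fin => h; rewrite /k.
  rewrite ler_pdivlMl//; move: h; rewrite /CL; lra.
move: ge le; case: (robin K) => [y| |]//.
  move=> h1 h2; congr EFin; apply: le_anti; apply/andP; split; first exact: h2.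
  by move: h1; rewrite lee_fin.
by move=> _ /(_ (k + 1) (leey _)); rewrite gerDl leNgt ltr01.
Qed.

(** Positive capacity forces a finite Robin constant: +oo gives [expeR -oo = 0], and -oo gives +oo,
    whose [fine] is 0. *)
Lemma cap_preimage (R : realType) (m : nat) (p : {poly cplx R}) (L : set (cplx R)) :
  (0 < m)%N -> size p = m.+1 -> measurable (L : set (borel_cplx R)) -> cbounded L ->
  0 < cap L -> cap [set z | L p.[z]] ^+ m = cap L / cmod (lead_coef p).
Proof.
move=> m0 hp mL Lb; rewrite /cap; case rL : (robin L) => [v| |] /=; rewrite ?ltxx//.
move=> _; rewrite (robin_preimage m0 hp mL Lb rL) /=.
have a0 : 0 < cmod (lead_coef p).
  by rewrite cmod_gt0 lead_coef_eq0 -size_poly_eq0 hp.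
rewrite -expRM_natl mulrN mulVKf; last by rewrite pnatr_eq0 -lt0n.
by rewrite opprD expRD !expRN lnK ?posrE.
Qed.

Theorem theorem10 (R : realType) (n m : nat) (hn : (1 <= n)%N) (hm : (1 <= m)%N)
    (L : set (cplx R)) (L_compact : compact L) (L_card : `I_n.+1 #<= L)
    (wL : cplx R -> R)
    (wL_ge0 : forall z, L z -> 0 <= wL z)
    (wL_bounded : exists M : R, forall z, L z -> wL z <= M)
    (wL_usc : usc_weight L wL)
    (wL_card : `I_n.+1 #<= [set z | L z /\ wL z != 0])
    (p : {poly cplx R}) (hp : size p = m.+1) :
  let K : set (cplx R) := [set z | L p.[z]] in
  let wK : cplx R -> R := fun z => wL p.[z] in
  [/\ forall z : cplx R,
        (chebyshev K wK (n * m)).[z] = (chebyshev L wL n).[p.[z]] / p`_m ^+ n,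
      cheb_norm K wK (n * m) = cheb_norm L wL n / cmod (p`_m ^+ n) &
      0 < cap L -> widom K wK (n * m) = widom L wL n].
Proof.
move=> K wK; have Lb := compact_cbounded L_compact; have [M wM] := wL_bounded.
have mL : measurable (L : set (borel_cplx R)).
  by apply: closed_borel; apply: compact_closed => //; exact: norm_hausdorff.
have [y y_inj Ey] : exists2 y : 'I_n.+1 -> cplx R, injective y &
    forall i, L (y i) /\ wL (y i) != 0.
  have /pcard_leP[f] := wL_card; exists (fun i => f i) => [i j|i].
    by move=> /(@inj _ _ _ f) ij; apply: val_inj; apply: ij; rewrite inE /=.
  by have := @funS _ _ _ _ f i; apply => /=.
have [T hT] : exists T, is_chebyshev L wL n T.
  (* Interpolating a monic polynomial of degree n takes n nodes; all n + 1 points enter in the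
     positivity of the norm. *)
  apply: (is_chebyshev_exists Lb wL_ge0 wM (y := fun i => y (widen_ord (leqnSn n) i))).
    by move=> i j /y_inj [] ij; apply: val_inj.
  by move=> i; exact: Ey.
have T0 : 0 < wnorm L wL T.
  have [Tm sT _] := hT.
  by apply: (wnorm_gt0 Lb wL_ge0 wM y_inj Ey); rewrite ?sT// monic_neq0.
have [E1 E2 E3] := chebyshev_comp Lb wL_ge0 wM hm hp hT T0.
have lE : lead_coef p = p`_m by rewrite lead_coefE hp.
rewrite lE in E2 E3; split => //.
  by move=> z; rewrite E2 E1 hornerZ horner_comp mulrC.
(* The power of [cap K] is regrouped as the n-th power of [cap K ^+ m], the quantity that
   [cap_preimage] evaluates. *)
move=> cL; rewrite /widom E3 mulnC exprM.
rewrite (cap_preimage hm hp mL Lb cL) lE cmodX expr_div_n.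
have a0 : cmod p`_m != 0.
  by rewrite cmod_eq0 -lE lead_coef_eq0 -size_poly_eq0 hp.
by rewrite invf_div mulrA divfK// expf_neq0.
Qed.
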